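(* Let $A\in\mathbb{R}^{K\times d}$, $y\in\mathbb{R}^K$, let $\Gamma\in\mathbb{R}^{K\times K}$, $\Gamma_0\in\mathbb{R}^{d\times d}$ be symmetric positive-definite, let $\Phi_R(u)=\frac12\|Au-y\|_\Gamma^2+\frac12\|u\|_{\Gamma_0}^2$, and set $$r=A^\top\Gamma^{-1}y,\qquad B=\bigl(A^\top\Gamma^{-1}A+\Gamma_0^{-1}\bigr)^{-1},\qquad u_0=Br .$$ Fix a vector $m_0\in\mathbb{R}^d$, a matrix $\mathcal{C}_0\in\mathbb{R}^{d\times d}$ and take as initial density the Gaussian distribution $$\rho_0(u):=\frac{1}{(2\pi)^{d/2}}(\det\mathcal{C}_0)^{-1/2}\exp\Bigl(-\tfrac12\|u-m_0\|_{\mathcal{C}_0}^2\Bigr)$$ with mean $m_0$ and covariance $\mathcal{C}_0$. Then the Gaussian profile $$\rho(t,u):=\frac{1}{(2\pi)^{d/2}}(\det\mathfrak{C}(t))^{-1/2}\exp\Bigl(-\tfrac12\|u-\mathfrak{m}(t)\|_{\mathfrak{C}(t)}^2\Bigr)$$ solves the nonlinear Fokker-Planck equation $$\partial_t\rho=\nabla\cdot\bigl(\rho\,\mathcal{C}(\rho)\nabla\Phi_R(u)\bigr)+\mathcal{C}(\rho):D^2\rho$$ with initial condition $\rho(0,u)=\rho_0(u)$, where $\mathfrak{m}(t)$ and $\mathfrak{C}(t)$ evolve according to $$\frac{d}{dt}\mathfrak{m}(t)=-\mathfrak{C}(t)\bigl(B^{-1}\mathfrak{m}(t)-r\bigr),\qquad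 \frac{d}{dt}\mathfrak{C}(t)=-2\,\mathfrak{C}(t)B^{-1}\mathfrak{C}(t)+2\,\mathfrak{C}(t),$$ with initial conditions $m_0$ and $\mathcal{C}_0$. As a consequence, for such initial conditions $\rho_0(u)$, the solution of this Fokker-Planck equation converges, as $t\to\infty$, to $\rho_\infty(u)$, the probability density given by $$\rho_\infty(u)\propto\exp\Bigl(-\tfrac12\|u-u_0\|_B^2\Bigr).$$
   Context: For any symmetric positive-definite matrix $M$, $\|a\|_M=\|M^{-1/2}a\|$ with the Euclidean norm on the right. $A_1:A_2$ denotes the Frobenius inner product of matrices $A_1,A_2$, and $D^2\rho$ the Hessian of $\rho$ in $u$. For a probability density $\rho$ on $\mathbb{R}^d$, $$m(\rho)=\int v\,\rho(v)\,dv,\qquad \mathcal{C}(\rho)=\int (v-m(\rho))\otimes(v-m(\rho))\,\rho(v)\,dv$$ denote its mean and covariance. *)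

(* Defs.v *)
From HB Require Import structures.
From mathcomp Require Import all_boot all_order all_algebra.
From mathcomp Require Import all_classical all_reals all_analysis.

Set Implicit Arguments.
Unset Strict Implicit.
Unset Printing Implicit Defensive.

Import Order.TTheory GRing.Theory Num.Theory.
Import numFieldNormedType.Exports.

Local Open Scope classical_set_scope.
Local Open Scope ring_scope.

(* Vectors of R^d are columns 'cV[R]_d. *)

Section matrices.
Context {R : realType}.

Definition spd n (M : 'M[R]_n) : Prop :=
  M^T = M /\ forall a : 'cV[R]_n, a != 0 -> 0 < (a^T *m M *m a) 0 0.

(* M^(1/2): the symmetric positive-definite square root, which exists and is
   unique when [spd M]; it is only used for such M. *)
Definition mxsqrt n (M : 'M[R]_n) : 'M[R]_n :=
  xget 0 [set S : 'M[R]_n | spd S /\ S *m S = M].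

(* The library norm `|a| on matrices is the sup norm, hence this definition. *)
Definition enorm n (a : 'cV[R]_n) : R := Num.sqrt (\sum_i a i 0 ^+ 2).

Definition wnorm n (M : 'M[R]_n) (a : 'cV[R]_n) : R :=
  enorm (invmx (mxsqrt M) *m a).

Definition frobenius n (A1 A2 : 'M[R]_n) : R :=
  \sum_i \sum_j A1 i j * A2 i j.

End matrices.

Section calculus.
Context {R : realType} {d : nat}.

Definition evec (i : 'I_d) : 'cV[R]_d := delta_mx i 0.

Definition grad (f : 'cV[R]_d -> R) (u : 'cV[R]_d) : 'cV[R]_d :=
  \col_i 'D_(evec i) f u.

Definition hessian (f : 'cV[R]_d -> R) (u : 'cV[R]_d) : 'M[R]_d :=
  \matrix_(i, j) 'D_(evec i) (fun v => 'D_(evec j) f v) u.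

Definition divergence (F : 'cV[R]_d -> 'cV[R]_d) (u : 'cV[R]_d) : R :=
  \sum_i 'D_(evec i) (fun v => F v i 0) u.

End calculus.

Section lebesgue_Rd.
Context {R : realType}.

Definition tcons n (p : n.-tuple (measurableTypeR R) * measurableTypeR R) :
    n.+1.-tuple (measurableTypeR R) :=
  [the n.+1.-tuple (measurableTypeR R) of p.2 :: p.1].

Lemma measurable_tcons n : measurable_fun [set: _] (@tcons n).
Proof. exact: (measurable_cons measurable_snd measurable_fst). Qed.

Definition lebesgueS n
    (mu : {measure set (n.-tuple (measurableTypeR R)) -> \bar R}) :
    set (n.+1.-tuple (measurableTypeR R)) -> \bar R :=
  pushforward (mu \x @lebesgue_measure R)%E (@tcons n).

Section lebesgueS_measure.
Context {n : nat} {mu : {measure set (n.-tuple (measurableTypeR R)) -> \bar R}}.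

Let lebesgueS0 : lebesgueS mu set0 = 0%E.
Proof. by rewrite /lebesgueS /pushforward preimage_set0 measure0. Qed.

Let lebesgueS_ge0 A : (0 <= lebesgueS mu A)%E.
Proof. by rewrite /lebesgueS /pushforward measure_ge0. Qed.

Let lebesgueS_sigma_additive : semi_sigma_additive (lebesgueS mu).
Proof.
have mT B : measurable B -> measurable (@tcons n @^-1` B).
  by move=> mB; rewrite -[X in measurable X]setTI; exact: measurable_tcons.
move=> F mF tF mUF; rewrite /lebesgueS /pushforward preimage_bigcup.
apply: measure_semi_sigma_additive.
- by move=> k; exact: mT.
- apply/trivIsetP => i j _ _ ij; rewrite -preimage_setI.
  by move/trivIsetP : tF => /(_ _ _ _ _ ij) ->//; rewrite preimage_set0.
- by rewrite -preimage_bigcup; exact: mT.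
Qed.

HB.instance Definition _ := isMeasure.Build _ _ _ (lebesgueS mu)
  lebesgueS0 lebesgueS_ge0 lebesgueS_sigma_additive.

End lebesgueS_measure.

(* Lebesgue measure on R^n: iterated product of the one-dimensional Lebesgue
   measure, carried by the library's product sigma-algebra on n-tuples. *)
Fixpoint lebesgue_Rd (n : nat) :
    {measure set (n.-tuple (measurableTypeR R)) -> \bar R} :=
  match n with
  | 0%N => dirac ([tuple] : 0.-tuple (measurableTypeR R))
  | k.+1 => lebesgueS (lebesgue_Rd k)
  end.

End lebesgue_Rd.

Section densities.
Context {R : realType} {d : nat}.
Implicit Types (f g : 'cV[R]_d -> R).

Definition col_of_tuple (x : d.-tuple (measurableTypeR R)) : 'cV[R]_d :=
  \col_i tnth x i.

Local Notation leb := (lebesgue_Rd d).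

Definition int_Rd f : R := \int[leb]_x f (col_of_tuple x).

Definition pdensity f : Prop :=
  [/\ forall u, 0 <= f u,
      measurable_fun [set: d.-tuple (measurableTypeR R)] (f \o col_of_tuple) &
      (\int[leb]_x (f (col_of_tuple x))%:E = 1)%E].

Definition finite_second_moment f : Prop :=
  forall i, leb.-integrable setT
    (fun x => (col_of_tuple x i 0 ^+ 2 * f (col_of_tuple x))%:E).

(* [int_Rd] returns a junk value on non-integrable functions: the mean and the
   covariance are meaningful under [pdensity] and [finite_second_moment]. *)
Definition mean f : 'cV[R]_d := \col_i int_Rd (fun v => v i 0 * f v).

Definition covariance_mx f : 'M[R]_d :=
  \matrix_(i, j)
    int_Rd (fun v => ((v - mean f) *m (v - mean f)^T) i j * f v).

Definition gaussian (m : 'cV[R]_d) (C : 'M[R]_d) (u : 'cV[R]_d) : R :=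
  ((2 * pi) `^ (d%:R / 2))^-1 * (\det C) `^ (- 2^-1) *
  expR (- 2^-1 * wnorm C (u - m) ^+ 2).

Definition normalized g (u : 'cV[R]_d) : R := g u / int_Rd g.

Definition L1_dist f g : \bar R :=
  (\int[leb]_x `|f (col_of_tuple x) - g (col_of_tuple x)|%:E)%E.

(* Classical solution on [0, +oo[: the equation holds for t > 0, where all the
   derivatives exist, and rho is continuous at t = 0, where it equals rho0. *)
Definition solves_fokker_planck (Phi rho0 : 'cV[R]_d -> R)
    (rho : R -> 'cV[R]_d -> R) : Prop :=
  let flux (t : R) (v : 'cV[R]_d) : 'cV[R]_d :=
    rho t v *: (covariance_mx (rho t) *m grad Phi v) in
  [/\ forall t : R, 0 <= t -> pdensity (rho t) /\ finite_second_moment (rho t),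
      forall u, rho 0 u = rho0 u /\ rho t u @[t --> 0^'+] --> rho0 u,
      forall (t : R) (u : 'cV[R]_d), 0 < t ->
        [/\ differentiable (rho t) u, differentiable (grad (rho t)) u &
            differentiable (flux t) u] &
      forall (t : R) (u : 'cV[R]_d), 0 < t ->
        is_derive t 1 (fun s => rho s u)
          (divergence (flux t) u
           + frobenius (covariance_mx (rho t)) (hessian (rho t) u))].

(* On [0, +oo[: derivatives at t > 0 and right-continuity at t = 0, which
   together give the one-sided derivative at t = 0. *)
Definition solves_moment_odes (B : 'M[R]_d) (r m0 : 'cV[R]_d) (C0 : 'M[R]_d)
    (m : R -> 'cV[R]_d) (C : R -> 'M[R]_d) : Prop :=
  [/\ m 0 = m0 /\ m t @[t --> 0^'+] --> m0,
      C 0 = C0 /\ C t @[t --> 0^'+] --> C0,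
      forall t : R, 0 < t ->
        is_derive t 1 m (- (C t *m (invmx B *m m t - r))) &
      forall t : R, 0 < t ->
        is_derive t 1 C (- 2 *: (C t *m invmx B *m C t) + 2 *: C t)].

End densities.

(* Main.v *)
Require Import Defs.
From HB Require Import structures.
From mathcomp Require Import all_boot all_order all_algebra.
From mathcomp Require Import all_classical all_reals all_analysis.
From mathcomp Require Import measurable_realfun complex ring lra.

Set Implicit Arguments.
Unset Strict Implicit.
Unset Printing Implicit Defensive.

Import Order.TTheory GRing.Theory Num.Theory.
Import numFieldNormedType.Exports.

Local Open Scope classical_set_scope.
Local Open Scope ring_scope.

(** Write [Bi] for the inverse of [B], and read the dynamics through the
    precision [Q t], the inverse of the covariance [C t].  The Riccati equation
    C' = -2 C Bi C + 2 C becomes the linear equation Q' = 2 (Bi - Q), so that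
    Q t = (1 - e^(-2t)) Bi + e^(-2t) C0^-1: a positive combination of two
    positive-definite matrices, hence positive-definite, and tending to [Bi]
    ([precision], [spd_precision], [cvg_precision]).  A given solution [C] is
    known neither to be symmetric nor to be invertible; but D = Q C - 1 solves
    the linear equation D' = -2 D Bi C with D 0 = 0, and Gronwall's inequality
    forces D = 0 ([precision_unique]).

    For the mean, let w = m - u0, so that w' = - C Bi w.  The matrices C0^-1 and
    [Bi] are simultaneously diagonalised by a congruence [G] ([simult_diag]),
    which turns [Q t] into a diagonal matrix with entries d_i, where
    d_i' = 2 (lam_i - d_i), and w into coordinates z = G w with
    d_i z_i' = - lam_i z_i.  Then d_i z_i^2 has derivative -2 d_i z_i^2, which
    gives m t -> u0 for every solution ([cvg_deviation0]); conversely
    z_i = e^(-t) / sqrt d_i * z_i(0) provides a solution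
    ([moment_odes_explicit]).

    That the Gaussian profile solves the Fokker-Planck equation is a computation.
    With w = u - m t and g the density, both sides equal
      g * (tr (C Bi) - d - <w, Bi u - r> + <w, Q w>):
    the divergence and Hessian terms are [divergence_flux_gauss] and
    [frobenius_gauss], and the time derivative is [is_derive_gaussP], where the
    trace comes from the prefactor sqrt (det Q) ([is_derive_sqrt_det]).  The
    equation is nonlinear through the covariance of the density itself, so it
    must be known that the Gaussian has mass one, mean [m] and covariance [C].
    The mass is computed by induction on the dimension: integrate the first
    coordinate out by completing the square, and what remains is the Gaussian of
    the Schur complement ([gauss_mass]).  A shift of the mean then yields the
    moment generating function ([gaussian_mgf]), whose first two derivatives at
    the origin are the moments ([mgf_moment1], [mgf_moment2]).

    Pointwise convergence of the densities is continuity in (m, Q)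
    ([cvg_gaussP]), and convergence in L1 follows from it by Scheffe's lemma
    ([scheffe]). *)

(** * Spectral theory of real symmetric matrices *)

Section spectral.
Context {R : realType}.

Lemma dotmx_sum n (u v : 'rV[R]_n) : (u *m v^T) 0 0 = \sum_i u 0 i * v 0 i.
Proof. by rewrite mxE; apply: eq_bigr => i _; rewrite mxE. Qed.

Lemma dotmx_ge0 n (u : 'rV[R]_n) : 0 <= (u *m u^T) 0 0.
Proof. by rewrite dotmx_sum sumr_ge0// => i _; rewrite -expr2 sqr_ge0. Qed.

Lemma dotmx_eq0 n (u : 'rV[R]_n) : (u *m u^T) 0 0 = 0 -> u = 0.
Proof.
rewrite dotmx_sum => /eqP; rewrite psumr_eq0; last first.
  by move=> i _; rewrite -expr2 sqr_ge0.
move=> /allP h; apply/rowP => i; rewrite mxE.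
by have /(_ (mem_index_enum i)) := h i; rewrite -expr2 sqrf_eq0 => /eqP.
Qed.

(** A complex eigenvector exists for dimension reasons.  Comparing v1 A v2^T
    with v2 A v1^T, where v1 and v2 are its real and imaginary parts, shows by
    symmetry of A that the eigenvalue has zero imaginary part; v1 or v2,
    which do not both vanish, is then a real eigenvector. *)
Lemma sym_eigenvector n (A : 'M[R]_n) : (0 < n)%N -> A^T = A ->
  exists a : R, exists2 v : 'rV[R]_n, v *m A = a *: v & v != 0.
Proof.
move=> n0 symA.
have [z /eigenvalueP[w wA w0]] :=
  eigenvalue_closed (map_mx (@real_complex_def _ (Phant R)) A) n0.
pose v1 := map_mx (@complex.Re R) w; pose v2 := map_mx (@complex.Im R) w.
have ReAE j : \sum_k v1 0 k * A k j = complex.Re z * v1 0 j - complex.Im z * v2 0 j.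
  move/rowP/(_ j): wA => wAj; have e := congr1 (@complex.Re R) wAj.
  transitivity (complex.Re ((z *: w) 0 j)).
    rewrite -e mxE raddf_sum /=; apply: eq_bigr => k _; rewrite !mxE.
    by case: (w 0 k) => a b /=; ring.
  by rewrite !mxE; case: (z) (w 0 j) => a b [c f] /=; ring.
have ImAE j : \sum_k v2 0 k * A k j = complex.Re z * v2 0 j + complex.Im z * v1 0 j.
  move/rowP/(_ j): wA => wAj; have e := congr1 (@complex.Im R) wAj.
  transitivity (complex.Im ((z *: w) 0 j)).
    rewrite -e mxE raddf_sum /=; apply: eq_bigr => k _; rewrite !mxE.
    by case: (w 0 k) => a b /=; ring.
  by rewrite !mxE; case: (z) (w 0 j) => a b [c f] /=; ring.
have ReA : v1 *m A = complex.Re z *: v1 - complex.Im z *: v2.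
  by apply/rowP => j; rewrite mxE ReAE !mxE.
have ImA : v2 *m A = complex.Re z *: v2 + complex.Im z *: v1.
  by apply/rowP => j; rewrite mxE ImAE !mxE.
have v12 : v1 != 0 \/ v2 != 0.
  apply/orP; rewrite -negb_and; apply: contra w0 => /andP[/eqP h1 /eqP h2].
  apply/eqP/rowP => j; move/rowP/(_ j): h1; move/rowP/(_ j): h2; rewrite !mxE.
  by case: (w 0 j) => a b /= -> ->.
have Im0 : complex.Im z = 0.
  have : (v1 *m A *m v2^T) 0 0 = (v2 *m A *m v1^T) 0 0.
    rewrite -[in LHS](trmxK (v1 *m A *m v2^T)) [LHS]mxE !trmx_mul trmxK symA.
    by rewrite mulmxA.
  rewrite ReA ImA mulmxBl mulmxDl -!scalemxAl.
  have eD (a b : R) (X Y : 'M[R]_1) : (a *: X + b *: Y) 0 0 = a * X 0 0 + b * Y 0 0.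
    by rewrite !mxE.
  have eB (a b : R) (X Y : 'M[R]_1) : (a *: X - b *: Y) 0 0 = a * X 0 0 - b * Y 0 0.
    by rewrite !mxE.
  rewrite eB eD !dotmx_sum => e.
  have {e} : complex.Im z * ((v1 *m v1^T) 0 0 + (v2 *m v2^T) 0 0) = 0.
    rewrite !dotmx_sum.
    have c : \sum_i v1 0 i * v2 0 i = \sum_i v2 0 i * v1 0 i.
      by apply: eq_bigr => i _; rewrite mulrC.
    rewrite c in e; lra.
  move=> /eqP; rewrite mulf_eq0 => /orP[/eqP//|/eqP s0].
  have s1 := dotmx_ge0 v1; have s2 := dotmx_ge0 v2.
  have /dotmx_eq0 h1 : (v1 *m v1^T) 0 0 = 0 by lra.
  have /dotmx_eq0 h2 : (v2 *m v2^T) 0 0 = 0 by lra.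
  by move: v12; rewrite h1 h2 eqxx => -[].
exists (complex.Re z); case: v12 => vn0.
  by exists v1 => //; rewrite ReA Im0 scale0r subr0.
by exists v2 => //; rewrite ImA Im0 scale0r addr0.
Qed.

(** The Householder reflection exchanging [v] and the first basis vector. *)
Lemma orthogonal_first_row n (v : 'rV[R]_n.+1) : (v *m v^T) 0 0 = 1 ->
  exists2 O : 'M[R]_n.+1, O *m O^T = 1%:M & row 0 O = v.
Proof.
move=> v1; pose e : 'rV[R]_n.+1 := delta_mx 0 0; pose w := v - e.
have [/eqP|w0] := eqVneq w 0.
  rewrite subr_eq0 => /eqP ->; exists 1%:M; first by rewrite trmx1 mulmx1.
  by rewrite row1.
have eT (u : 'rV[R]_n.+1) : (e *m u^T) 0 0 = u 0 0.
  by rewrite -rowE mxE mxE.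
have Te (u : 'rV[R]_n.+1) : (u *m e^T) 0 0 = u 0 0.
  by rewrite trmx_delta -colE mxE.
pose s := (w *m w^T) 0 0.
have wwT : w *m w^T = s%:M by rewrite [LHS]mx11_scalar.
have sE : s = 2 - 2 * v 0 0.
  rewrite /s /w linearB /= mulmxBl !mulmxBr.
  have eB (X Y Z W : 'M[R]_1) : (X - Y - (Z - W)) 0 0 = X 0 0 - Y 0 0 - (Z 0 0 - W 0 0).
    by rewrite !mxE.
  by rewrite eB v1 Te !eT mxE !eqxx /=; ring.
have s0 : s != 0 by apply: contra w0 => /eqP/dotmx_eq0/eqP.
pose O := 1%:M - (2 / s) *: (w^T *m w).
have OT : O^T = O by rewrite /O linearB linearZ /= trmx1 trmx_mul trmxK.
exists O.
  rewrite OT /O; set X := _ *: _.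
  have XX : X *m X = 2 *: X.
    rewrite /X -scalemxAl -scalemxAr -mulmxA [w *m (w^T *m w)]mulmxA wwT.
    rewrite mul_scalar_mx -scalemxAr !scalerA; congr (_ *: _).
    by field.
  rewrite mulmxBl !mulmxBr mul1mx mulmx1 mul1mx XX scalerDl scale1r.
  by rewrite opprB addrK subrK.
rewrite rowE mulmxBr mulmx1 -scalemxAr mulmxA.
rewrite [delta_mx 0 0 *m w^T]mx11_scalar eT mul_scalar_mx scalerA.
have -> : 2 / s * w 0 0 = -1.
  have -> : w 0 0 = - (s / 2) by rewrite sE /w !mxE eqxx /=; field.
  by field.
by rewrite scaleN1r opprK addrC subrK.
Qed.

Lemma sym_block_diag n (A : 'M[R]_(1 + n)) (a : R) : A^T = A ->
  (forall j, A 0 j = a * (j == 0)%:R) -> A = block_mx a%:M 0 0 (drsubmx A).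
Proof.
move=> symA A0; have l0 : lshift n (0 : 'I_1) = 0 by exact/val_inj.
rewrite -[LHS]submxK; congr block_mx.
- by rewrite [LHS]mx11_scalar !mxE l0 A0 mulr1.
- apply/matrixP => i j; rewrite !ord1 !mxE l0 A0 (_ : _ == _ = false) ?mulr0//.
- apply/matrixP => i j; rewrite !ord1 !mxE l0 -symA mxE A0.
  by rewrite (_ : _ == _ = false) ?mulr0.
Qed.

(** Deflation: in an orthonormal basis starting with a unit eigenvector the
    matrix is block diagonal, and the induction applies to the lower block. *)
Theorem sym_spectral n (A : 'M[R]_n) : A^T = A ->
  exists O : 'M[R]_n, exists D : 'rV[R]_n,
    O *m O^T = 1%:M /\ A = O^T *m diag_mx D *m O.
Proof.
elim: n A => [|n IH] A symA.
  by exists 1%:M, 0; split; [rewrite trmx1 mulmx1 | apply/matrixP => -[]].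
have [a [v0 v0A v00]] := sym_eigenvector (ltn0Sn n) symA.
pose s := (v0 *m v0^T) 0 0.
have s0 : 0 < s.
  rewrite lt_neqAle dotmx_ge0 andbT eq_sym.
  by apply: contra v00 => /eqP/dotmx_eq0/eqP.
pose v := (Num.sqrt s)^-1 *: v0.
have vA : v *m A = a *: v by rewrite -scalemxAl v0A scalerA mulrC -scalerA.
have v1 : (v *m v^T) 0 0 = 1.
  rewrite linearZ /= -scalemxAl -scalemxAr 2!mxE -/s mulrA -invfM -expr2.
  by rewrite sqr_sqrtr ?ltW// mulVf// gt_eqF.
have [ O OO rO] := orthogonal_first_row v1.
have OTO : O^T *m O = 1%:M by apply: mulmx1C.
pose A1 := O *m A *m O^T.
have symA1 : A1^T = A1 by rewrite /A1 !trmx_mul trmxK symA mulmxA.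
have rA1 : row 0 A1 = a *: delta_mx 0 0.
  rewrite /A1 !row_mul rO vA -scalemxAl; congr (_ *: _).
  by rewrite -rO -row_mul OO row1.
have A10 j : A1 0 j = a * (j == 0)%:R.
  by move/rowP/(_ j): rA1; rewrite !mxE eqxx.
pose A2 : 'M[R]_(1 + n) := A1.
have /IH[P [D [PP A2E]]] : (drsubmx A2)^T = drsubmx A2.
  by rewrite trmx_drsub symA1.
have A1E : A1 = block_mx a%:M 0 0 (P^T *m diag_mx D *m P) :> 'M[R]_(1 + n).
  by rewrite -A2E; exact: sym_block_diag.
pose Q : 'M[R]_(1 + n) := block_mx 1%:M 0 0 P.
pose E : 'rV[R]_(1 + n) := row_mx a%:M D.
have QT : Q^T = block_mx 1%:M 0 0 P^T by rewrite tr_block_mx !trmx0 trmx1.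
have QQ : Q *m Q^T = 1%:M.
  rewrite QT mulmx_block !mul1mx !mul0mx !mulmx0 !addr0 !add0r PP.
  by rewrite -scalar_mx_block.
have QE : A1 = Q^T *m diag_mx E *m Q.
  rewrite A1E QT diag_mx_row !mulmx_block.
  rewrite !(mul1mx, mul0mx, mulmx0, mulmx1, addr0, add0r).
  by rewrite (_ : diag_mx a%:M = a%:M)//; apply/matrixP => i j; rewrite !ord1 !mxE eqxx.
exists (Q *m O), E; rewrite trmx_mul; split.
  by rewrite mulmxA -[_ *m O *m _]mulmxA OO mulmx1 QQ.
have -> : A = O^T *m A1 *m O.
  by rewrite /A1 !mulmxA OTO mul1mx -mulmxA OTO mulmx1.
by rewrite QE !mulmxA.
Qed.

End spectral.

(** * Symmetric positive-definite matrices *)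

Section spd_theory.
Context {R : realType}.

Lemma trmx_congr m n (P : 'M[R]_(m, n)) (M : 'M[R]_m) : M^T = M ->
  (P^T *m M *m P)^T = P^T *m M *m P.
Proof. by move=> sM; rewrite !trmx_mul trmxK sM mulmxA. Qed.

Lemma spd_unit n (M : 'M[R]_n) : spd M -> M \in unitmx.
Proof.
move=> [symM posM]; rewrite -row_free_unit -kermx_eq0.
apply/negPn/negP => /rowV0Pn[v /sub_kermxP vM v0].
have := posM v^T; rewrite trmx_eq0 => /(_ v0).
by rewrite trmxK vM mul0mx mxE ltxx.
Qed.

Lemma spd_congr m n (M : 'M[R]_m) (P : 'M[R]_(m, n)) : spd M ->
  (forall a : 'cV_n, P *m a = 0 -> a = 0) -> spd (P^T *m M *m P).
Proof.
move=> [symM posM] Pinj; split; first exact: trmx_congr.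
move=> a a0; have := posM (P *m a).
by rewrite trmx_mul !mulmxA; apply; apply: contra a0 => /eqP/Pinj ->.
Qed.

Lemma spd_congr_unit n (M P : 'M[R]_n) : spd M -> P \in unitmx ->
  spd (P^T *m M *m P).
Proof.
move=> spdM uP; apply: spd_congr => // a Pa.
by rewrite -[a](mulKmx uP) Pa mulmx0.
Qed.

Lemma spd_inv n (M : 'M[R]_n) : spd M -> spd (invmx M).
Proof.
move=> spdM; have uM := spd_unit spdM.
have := spd_congr_unit spdM (_ : invmx M \in unitmx).
by rewrite unitmx_inv uM trmx_inv (proj1 spdM) mulVmx// mul1mx => /(_ isT).
Qed.

Lemma psd_spd_add n (M N : 'M[R]_n) : M^T = M ->
  (forall a : 'cV_n, 0 <= (a^T *m M *m a) 0 0) -> spd N -> spd (M + N).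
Proof.
move=> symM posM [symN posN]; split; first by rewrite linearD /= symM symN.
by move=> a a0; rewrite mulmxDr mulmxDl mxE ltr_wpDl// posN.
Qed.

Lemma spd_psd n (M : 'M[R]_n) (a : 'cV_n) : spd M -> 0 <= (a^T *m M *m a) 0 0.
Proof.
move=> [_ pM]; have [->|a0] := eqVneq a 0; first by rewrite mulmx0 mxE.
exact/ltW/pM.
Qed.

Lemma spd_scale n (M : 'M[R]_n) (c : R) : 0 < c -> spd M -> spd (c *: M).
Proof.
move=> c0 [symM posM]; split; first by rewrite linearZ /= symM.
by move=> a a0; rewrite -scalemxAr -scalemxAl mxE mulr_gt0// posM.
Qed.

Lemma diag_quad n (D : 'rV[R]_n) (a : 'cV[R]_n) :
  (a^T *m diag_mx D *m a) 0 0 = \sum_i D 0 i * a i 0 ^+ 2.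
Proof.
rewrite -mulmxA mxE; apply: eq_bigr => i _.
by rewrite mul_diag_mx !mxE; ring.
Qed.

(** Used to read off that the eigenvalues of a positive-definite matrix are
    positive. *)
Lemma spd_diag n (D : 'rV[R]_n) : spd (diag_mx D) <-> forall i, 0 < D 0 i.
Proof.
split=> [[_ pD] i|D0].
  have := pD (delta_mx i 0); rewrite diag_quad (bigD1 i)//= big1 => [|j ji].
    rewrite mxE !eqxx /= expr1n mulr1 addr0; apply.
    apply/eqP => /matrixP/(_ i 0); rewrite !mxE !eqxx => /eqP.
    by rewrite oner_eq0.
  by rewrite mxE (negbTE ji) expr0n mulr0.
split; first exact: tr_diag_mx.
move=> a a0; rewrite diag_quad lt_neqAle sumr_ge0 ?andbT; last first.
  by move=> i _; rewrite mulr_ge0 ?sqr_ge0// ltW.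
apply: contra a0; rewrite eq_sym psumr_eq0; last first.
  by move=> i _; rewrite mulr_ge0 ?sqr_ge0// ltW.
move=> /allP h; apply/eqP/colP => i; rewrite mxE.
have /(_ (mem_index_enum i)) := h i.
by rewrite mulf_eq0 gt_eqF //= sqrf_eq0 => /eqP.
Qed.

Lemma spd_sqrt n (M : 'M[R]_n) : spd M ->
  exists S : 'M[R]_n, spd S /\ S *m S = M.
Proof.
move=> spdM; have [ O [D [OO ME]]] := sym_spectral (proj1 spdM).
have OTO : O^T *m O = 1%:M by apply: mulmx1C.
have uO : O^T \in unitmx by case/mulmx1_unit: OTO.
have D0 : forall i, 0 < D 0 i.
  apply/spd_diag; have := spd_congr_unit spdM uO.
  by rewrite trmxK ME !mulmxA OO mul1mx -mulmxA OO mulmx1.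
pose S := O^T *m diag_mx (map_mx Num.sqrt D) *m O.
exists S; split.
  apply: spd_congr_unit; last by rewrite -unitmx_tr.
  by apply/spd_diag => i; rewrite mxE sqrtr_gt0.
rewrite /S !mulmxA -[_ *m O *m O^T]mulmxA OO mulmx1.
rewrite -[_ *m diag_mx _ *m diag_mx _]mulmxA mulmx_diag ME; congr (_ *m diag_mx _ *m _).
by apply/rowP => i; rewrite !mxE -expr2 sqr_sqrtr// ltW.
Qed.

(** [mxsqrt M] is only specified as some positive-definite square root of [M];
    any such root S satisfies |S^-1 a|^2 = <a, M^-1 a>. *)
Lemma wnormE n (M : 'M[R]_n) (a : 'cV[R]_n) : spd M ->
  wnorm M a ^+ 2 = (a^T *m invmx M *m a) 0 0.
Proof.
move=> spdM; have [S spdS] := spd_sqrt spdM.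
rewrite /wnorm /mxsqrt.
case: (xgetP 0 [set S : 'M[R]_n | spd S /\ S *m S = M]) => [T _ /= [sT <-]|/(_ S)//].
have uT := spd_unit sT.
rewrite /enorm sqr_sqrtr; last by rewrite sumr_ge0// => i _; rewrite sqr_ge0.
have -> : invmx (T *m T) = (invmx T)^T *m invmx T.
  rewrite trmx_inv (proj1 sT).
  have uTT : T *m T \in unitmx by rewrite unitmx_mul uT.
  have e : invmx T *m invmx T *m (T *m T) = 1%:M.
    by rewrite mulmxA mulmxKV// mulVmx.
  by rewrite -[RHS]mulmx1 -(mulmxV uTT) mulmxA e mul1mx.
rewrite mulmxA -trmx_mul -mulmxA [RHS]mxE.
by apply: eq_bigr => i _; rewrite [in RHS]mxE expr2.
Qed.

(** Take a square root S of [M], diagonalise S^-1 N S^-1 orthogonally as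
    O^T D O, and set G = O S. *)
Lemma simult_diag n (M N : 'M[R]_n) : spd M -> N^T = N ->
  exists G : 'M[R]_n, exists D : 'rV[R]_n,
    [/\ G \in unitmx, M = G^T *m G & N = G^T *m diag_mx D *m G].
Proof.
move=> spdM symN; have [S [spdS SS]] := spd_sqrt spdM.
have uS := spd_unit spdS; have symS := proj1 spdS.
have symV : (invmx S)^T = invmx S by rewrite trmx_inv symS.
have := @trmx_congr _ _ (invmx S) N symN; rewrite symV.
move=> /sym_spectral[ O [D [OO NE]]].
have OTO : O^T *m O = 1%:M by apply: mulmx1C.
exists (O *m S), D; split.
- by rewrite unitmx_mul uS andbT; case/mulmx1_unit: OO.
- by rewrite trmx_mul mulmxA -[_ *m O^T *m O]mulmxA OTO mulmx1 symS.
- have -> : N = S *m (invmx S *m N *m invmx S) *m S.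
    by rewrite !mulmxA mulmxV// mul1mx mulmxKV.
  by rewrite NE trmx_mul symS !mulmxA.
Qed.

End spd_theory.

(** * Lebesgue measure on tuples as an iterated integral *)

Section tonelli.
Context {R : realType}.

(** The inverse of [tcons]; its measurability transports sets of the product
    space to sets of tuples. *)
Definition tuncons n (t : n.+1.-tuple (measurableTypeR R)) :
    n.-tuple (measurableTypeR R) * measurableTypeR R :=
  ([tuple of behead t], thead t).

Lemma tconsK n : cancel (@tcons R n) (@tuncons n).
Proof. by move=> [x y]; rewrite /tuncons /tcons theadE; congr pair; exact/val_inj. Qed.

Lemma measurable_tuncons n : measurable_fun setT (@tuncons n).
Proof.
apply/measurable_fun_pairP; split => /=.
  exact: measurable_behead.
exact: measurable_tnth.
Qed.

(** Bundles a proof of sigma-finiteness with the measure, the form in which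
    Tonelli's theorem expects it. *)
Lemma sigma_finite_measureP d (T : measurableType d)
    (mu : {measure set T -> \bar R}) : sigma_finite setT mu ->
  exists m : {sigma_finite_measure set T -> \bar R},
    mu = m :> {measure set T -> \bar R}.
Proof.
move=> smu.
pose H1 := isSFinite.Build _ _ _ _ (sfinite_measure_sigma_finite smu).
pose H2 := isSigmaFinite.Build _ _ _ _ smu.
pose m : {sigma_finite_measure set T -> \bar R} :=
  HB.pack (Measure.sort mu) H1 H2.
by exists m; exact: eq_measure.
Qed.

(** Both exhaustions are taken nondecreasing, so that the products of sets of
    equal index cover. *)
Lemma lebesgueS_sigma_finite n
    (mu : {measure set (n.-tuple (measurableTypeR R)) -> \bar R}) :
  sigma_finite setT mu -> sigma_finite setT (lebesgueS mu).
Proof.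
move=> /sigma_finiteP[F [TF ndF Foo]].
have /sigma_finiteP[G [TG ndG Goo]] := sigma_finiteT (@lebesgue_measure R).
exists (fun i => @tuncons n @^-1` (F i `*` G i)).
  rewrite -preimage_bigcup; apply/esym; rewrite -subTset => t _ /=.
  have : (\bigcup_i F i) (tuncons t).1 by rewrite -TF.
  have : (\bigcup_i G i) (tuncons t).2 by rewrite -TG.
  move=> [k _ Gk] [j _ Fj]; exists (maxn j k) => //=; split.
    by move: Fj; exact/subsetPset/ndF/leq_maxl.
  by move: Gk; exact/subsetPset/ndG/leq_maxr.
move=> i; have [mF Fi] := Foo i; have [mG Gi] := Goo i; split.
  rewrite -[X in measurable X]setTI; apply: measurable_tuncons => //.
  exact: measurableX.
rewrite /lebesgueS /pushforward -comp_preimage.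
rewrite (_ : _ \o _ = id); last by apply/funext => x; exact: tconsK.
rewrite preimage_id product_measure1E// lte_mul_pinfty// ge0_fin_numE//.
Qed.

Lemma lebesgue_Rd_sigma_finite n : sigma_finite setT (@lebesgue_Rd R n).
Proof.
elim: n => [|n IH]; last exact: lebesgueS_sigma_finite.
exists (fun=> setT); first by rewrite bigcup_const.
by move=> i; split => //=; rewrite diracT ltry.
Qed.

Lemma integral_lebesgueS n
    (mu : {measure set (n.-tuple (measurableTypeR R)) -> \bar R})
    (f : n.+1.-tuple (measurableTypeR R) -> \bar R) :
  sigma_finite setT mu ->
  measurable_fun setT f ->
  (forall t, 0 <= f t)%E ->
  (\int[lebesgueS mu]_t f t =
   \int[mu]_x \int[@lebesgue_measure R]_y f (tcons (x, y)))%E.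
Proof.
move=> /sigma_finite_measureP[m ->] mf f0.
have mt := @measurable_tcons R n.
transitivity (\int[m \x @lebesgue_measure R]_z (f \o @tcons R n) z)%E.
  exact: (@ge0_integral_pushforward _ _ _ _ _ (@tcons R n) mt
    (m \x @lebesgue_measure R)%E setT f).
have mft : measurable_fun setT (f \o @tcons R n) := measurableT_comp mf mt.
by rewrite (fubini_tonelli1 _ mft)//= => -[x y] /=.
Qed.

End tonelli.

(** * The mass of a Gaussian *)

Section gaussian_mass.
Context {R : realType}.

Definition quad n (P : 'M[R]_n) (w : 'cV[R]_n) : R := (w^T *m P *m w) 0 0.

(** The total mass of a normal density, freed of its normalisation. *)
Lemma integral_gauss1 (p c : R) : 0 < p ->
  (\int[@lebesgue_measure R]_y (expR (- 2^-1 * (p * (y - c) ^+ 2)))%:E =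
   (Num.sqrt (2 * pi / p))%:E)%E.
Proof.
move=> p0; pose s := Num.sqrt p^-1.
have s0 : 0 < s by rewrite sqrtr_gt0 invr_gt0.
have s2 : s ^+ 2 = p^-1 by rewrite sqr_sqrtr// invr_ge0 ltW.
have sn0 : s != 0 by rewrite gt_eqF.
have pk : Num.sqrt (2 * pi / p) * normal_peak s = 1.
  rewrite /normal_peak s2 (_ : p^-1 * pi *+ 2 = 2 * pi / p); last by ring.
  by rewrite mulfV// gt_eqF// sqrtr_gt0 divr_gt0// mulr_gt0// pi_gt0.
transitivity (\int[@lebesgue_measure R]_y
    ((Num.sqrt (2 * pi / p))%:E * (normal_pdf c s y)%:E))%E.
  apply: eq_integral => y _; rewrite /normal_pdf (negbTE sn0) -EFinM [in RHS]mulrA pk mul1r.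
  congr (expR _)%:E; rewrite /normal_fun s2.
  by field; rewrite gt_eqF.
rewrite ge0_integralZl//=.
- by rewrite integral_normal_pdf mule1.
- by apply/measurable_EFinP; exact: measurable_normal_pdf.
- by move=> y _; rewrite lee_fin normal_pdf_ge0.
Qed.

Lemma measurable_col_coord n i :
  measurable_fun setT (fun x : n.-tuple (measurableTypeR R) => col_of_tuple x i 0).
Proof. by under eq_fun do rewrite mxE; exact: measurable_tnth. Qed.

Lemma measurable_lin n (a : 'rV[R]_n) (m : 'cV[R]_n) :
  measurable_fun setT
    (fun x : n.-tuple (measurableTypeR R) => (a *m (col_of_tuple x - m)) 0 0).
Proof.
under eq_fun do rewrite mxE.
apply: measurable_sum => i; apply: measurable_funM => //.
under eq_fun do rewrite mxE; apply: measurable_funD.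
  exact: measurable_col_coord.
exact: measurable_cst.
Qed.

Lemma measurable_quad n (P : 'M[R]_n) (m : 'cV[R]_n) :
  measurable_fun setT
    (fun x : n.-tuple (measurableTypeR R) => quad P (col_of_tuple x - m)).
Proof.
rewrite /quad; under eq_fun do rewrite -mulmxA mxE.
apply: measurable_sum => i; apply: measurable_funM => //.
  under eq_fun do rewrite mxE mxE; apply: measurable_funD.
    exact: measurable_col_coord.
  exact: measurable_cst.
apply: eq_measurable_fun (measurable_lin (row i P) m) => x _.
by rewrite -row_mul mxE.
Qed.

End gaussian_mass.

Section schur.
Context {R : realType} {n : nat}.
Variable P : 'M[R]_(1 + n).
Hypothesis spdP : spd P.

Let p := P 0 0.
Let q : 'cV[R]_n := dlsubmx P.
Definition schur_compl : 'M[R]_n :=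
  drsubmx P - p^-1 *: (q *m q^T).

Let PE : P = block_mx p%:M q^T q (drsubmx P).
Proof.
have l0 : lshift n (0 : 'I_1) = 0 by exact/val_inj.
rewrite -[LHS]submxK; congr block_mx.
  by rewrite [LHS]mx11_scalar !mxE l0.
by rewrite /q -[in RHS](proj1 spdP) trmx_dlsub trmxK.
Qed.

Let xq (x : 'cV[R]_n) : (x^T *m q) 0 0 = (q^T *m x) 0 0.
Proof.
have <- : (x^T *m q)^T = q^T *m x by rewrite trmx_mul trmxK.
by rewrite [RHS]mxE.
Qed.

Let quad_block (y : R) (x : 'cV[R]_n) :
  quad P (col_mx y%:M x) =
  p * y ^+ 2 + 2 * y * (q^T *m x) 0 0 + quad (drsubmx P) x.
Proof.
rewrite /quad {1}PE tr_col_mx mul_row_block mul_row_col tr_scalar_mx.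
rewrite !mul_scalar_mx mul_mx_scalar mulmxDl -scalemxAl.
have eD (X Y Z W : 'M[R]_1) :
    (y *: (X + Y) + (Z + W)) 0 0 = y * X 0 0 + y * Y 0 0 + Z 0 0 + W 0 0.
  by rewrite !mxE; ring.
rewrite eD xq.
have -> : (y *: p%:M : 'M[R]_1) 0 0 = y * p by rewrite !mxE eqxx mulr1n.
have -> : (y *: (q^T *m x)) 0 0 = y * (q^T *m x) 0 0 by rewrite mxE.
ring.
Qed.

Let quad_schur x :
  quad schur_compl x = quad (drsubmx P) x - p^-1 * (q^T *m x) 0 0 ^+ 2.
Proof.
rewrite /quad /schur_compl mulmxBr mulmxBl.
have eB (X Y : 'M[R]_1) : (X - Y) 0 0 = X 0 0 - Y 0 0 by rewrite !mxE.
rewrite eB -scalemxAr -scalemxAl; congr (_ - _).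
have -> (c : R) (X : 'M[R]_1) : (c *: X) 0 0 = c * X 0 0 by rewrite mxE.
congr (_ * _); rewrite -mulmxA -[q *m _ *m x]mulmxA [x^T *m _]mulmxA.
by rewrite [LHS]mxE big_ord1 xq expr2.
Qed.

Lemma schur_pivot_gt0 : 0 < P 0 0.
Proof.
have := proj2 spdP (col_mx 1%:M 0); rewrite -/(quad P _) quad_block.
rewrite mulmx0 mxE mulr0 addr0 expr1n mulr1 /quad mulmx0 mxE addr0; apply.
apply/eqP => /colP/(_ (lshift n 0)); rewrite col_mxEu !mxE eqxx => /eqP.
by rewrite oner_eq0.
Qed.

Let p0 : p != 0. Proof. by rewrite gt_eqF// schur_pivot_gt0. Qed.

(** Completing the square in the first coordinate [y]: the remaining
    coordinates only see the Schur complement. *)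
Lemma quad_schurE (y : R) (x : 'cV[R]_n) :
  quad P (col_mx y%:M x) =
  P 0 0 * (y - - ((P 0 0)^-1 * ((dlsubmx P)^T *m x) 0 0)) ^+ 2
  + quad schur_compl x.
Proof. by rewrite quad_block quad_schur -/p -/q; field. Qed.

(** Evaluate the form of [P] at the [y] that cancels the square in
    [quad_schurE]. *)
Lemma spd_schur_compl : spd schur_compl.
Proof.
split.
  rewrite /schur_compl linearB linearZ /= trmx_mul trmxK trmx_drsub.
  by rewrite (proj1 spdP).
move=> x x0; rewrite -/(quad _ _).
pose y := - (p^-1 * (q^T *m x) 0 0).
have := proj2 spdP (col_mx y%:M x); rewrite -/(quad P _) quad_schurE -/p -/q -/y.
rewrite subrr expr0n mulr0 add0r; apply.
by apply: contra x0; rewrite col_mx_eq0 => /andP[].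
Qed.

(** Column elimination by a unipotent block matrix [U]. *)
Lemma det_schur : \det P = P 0 0 * \det schur_compl.
Proof.
pose U : 'M[R]_(1 + n) := block_mx 1%:M (- p^-1 *: q^T) 0 1%:M.
have : P *m U = block_mx p%:M 0 q schur_compl.
  rewrite {1}PE /U mulmx_block !mulmx1 !mulmx0 !addr0.
  congr block_mx.
    by rewrite mul_scalar_mx scalerA mulrN divff// scaleN1r addNr.
  by rewrite -scalemxAr addrC scaleNr.
move=> /(congr1 determinant); rewrite det_mulmx det_lblock det_ublock.
by rewrite !det1 !mulr1 det_scalar1.
Qed.

End schur.

Section mass.
Context {R : realType}.

Lemma col_of_tcons n (x : n.-tuple (measurableTypeR R)) (y : R) (m : 'cV[R]_(1 + n)) :
  (col_of_tuple (tcons (x, y)) : 'cV[R]_(1 + n)) - m =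
  col_mx (y - m 0 0)%:M (col_of_tuple x - dsubmx m).
Proof.
apply/colP => i; rewrite !mxE; case: splitP => j ij; rewrite !mxE.
  rewrite ord1 eqxx mulr1n (_ : i = 0); last first.
    by apply/val_inj; rewrite /= ij ord1.
  by rewrite tnth0.
have -> : i = rshift 1 j by exact/val_inj.
by congr (_ - _); rewrite !(tnth_nth 0).
Qed.

(** Induction on the dimension: by [quad_schurE] the integral over the first
    coordinate is a one-dimensional Gaussian integral with a centre depending on
    the other coordinates, hence a constant, and the Schur complement remains. *)
Lemma gauss_mass n (P : 'M[R]_n) (m : 'cV[R]_n) : spd P ->
  (\int[lebesgue_Rd n]_x (expR (- 2^-1 * quad P (col_of_tuple x - m)))%:E =
   ((2 * pi) `^ (n%:R / 2) * (Num.sqrt (\det P))^-1)%:E)%E.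
Proof.
have mE k (Q : 'M[R]_k) (w : 'cV[R]_k) : measurable_fun setT
    (fun x => (expR (- 2^-1 * quad Q (col_of_tuple x - w)))%:E).
  apply/measurable_EFinP; apply: measurableT_comp => //.
  by apply: measurable_funM => //; exact: measurable_quad.
elim: n P m => [|n IH] P m spdP.
  rewrite /= integral_dirac//; last exact: mE.
  rewrite diracT mul1e det_mx00 sqrtr1 invr1 mulr1.
  by rewrite mul0r powRr0 /quad mxE big_ord0 mulr0 expR0.
have p0 := schur_pivot_gt0 spdP.
have := integral_lebesgueS (lebesgue_Rd_sigma_finite n) (mE n.+1 P m).
rewrite /= => ->; last by move=> t; rewrite lee_fin expR_ge0.
transitivity (\int[lebesgue_Rd n]_x ((Num.sqrt (2 * pi / P 0 0))%:E *
  (expR (- 2^-1 * quad (schur_compl P) (col_of_tuple x - dsubmx (m : 'cV[R]_(1 + n)))))%:E))%E.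
  apply: eq_integral => x _.
  set w := col_of_tuple x - _.
  pose c := m 0 0 - (P 0 0)^-1 * ((dlsubmx (P : 'M[R]_(1 + n)))^T *m w) 0 0.
  transitivity (\int[@lebesgue_measure R]_y
     ((expR (- 2^-1 * quad (schur_compl P) w))%:E *
      (expR (- 2^-1 * (P 0 0 * (y - c) ^+ 2)))%:E))%E.
    apply: eq_integral => y _.
    rewrite (col_of_tcons x y m) (quad_schurE spdP) -EFinM -expRD -/w.
    by congr (expR _)%:E; rewrite /c; ring.
  rewrite ge0_integralZl//; first by rewrite integral_gauss1// muleC.
  - apply/measurable_EFinP; apply: measurableT_comp => //.
    apply: measurable_funM => //; apply: measurable_funM => //.
    by apply: measurable_funX; exact: measurable_funB.
rewrite ge0_integralZl//.
- rewrite (IH _ _ (spd_schur_compl spdP)) -EFinM; congr EFin.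
  rewrite (det_schur spdP) (sqrtrM _ (ltW p0)) sqrtrM ?mulr_ge0 ?pi_ge0//.
  rewrite sqrtrV ?ltW// -powR12_sqrt ?mulr_ge0 ?pi_ge0//.
  rewrite (_ : n.+1%:R / 2 = n%:R / 2 + 2^-1); last by rewrite -[n.+1%:R]natr1; field.
  rewrite powRD; last first.
    by apply/implyP => _; rewrite gt_eqF// mulr_gt0// pi_gt0.
  by rewrite invfM; ring.
- exact: mE.
Qed.

End mass.

(** * Derivation rules for scalar functions *)

Section derive_helpers.
Context {R : realType} {V : normedModType R}.

(** The derivation rules are restated for functions given by explicit
    expressions, and with products in place of scalings, so that the computed
    derivatives are within reach of [ring]. *)
Lemma is_derive_mul (f g : V -> R) (x v : V) (df dg : R) :
  is_derive x v f df -> is_derive x v g dg ->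
  is_derive x v (fun y => f y * g y) (f x * dg + g x * df).
Proof. by move=> hf hg; exact: is_deriveM. Qed.

Lemma is_derive_const (c : R) (x v : V) : is_derive x v (fun=> c) 0.
Proof. exact: is_derive_cst. Qed.

Lemma is_derive_ident (W : normedModType R) (x v : W) :
  is_derive x v (fun y => y) v.
Proof. exact: is_derive_id. Qed.

End derive_helpers.

(** * Moments of a Gaussian *)

(** A nonnegative weight [g] for which [l] has the moment generating function
    s |-> exp (s^2 q / 2) has total mass 1, and [l] has mean 0 and variance [q]
    under it: differentiate twice under the integral sign at s = 0.  On
    |s| <= 1 the integrands l^k e^(s l) g with k <= 2 are dominated by
    (e^(3 l) + e^(-3 l)) g, because |l|^k <= e^(2 |l|). *)
Section mgf.
Context {R : realType} d (T : measurableType d) (mu : {measure set T -> \bar R}).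
Variables (g l : T -> R) (q : R).
Hypothesis mg : measurable_fun setT g.
Hypothesis ml : measurable_fun setT l.
Hypothesis g0 : forall x, 0 <= g x.
Hypothesis mgf : forall s,
  (\int[mu]_x (expR (s * l x) * g x)%:E = (expR (s ^+ 2 * (q / 2)))%:E)%E.

Let h k s x : R := l x ^+ k * expR (s * l x) * g x.

Let mh k s : measurable_fun setT (h k s).
Proof.
apply: measurable_funM => //; apply: measurable_funM.
  exact: measurable_funX.
by apply: measurableT_comp => //; exact: measurable_funM.
Qed.

Let exp_integrable s :
  mu.-integrable setT (EFin \o (fun x => expR (s * l x) * g x)).
Proof.
apply/integrableP; split.
  apply/measurable_EFinP; rewrite (_ : (fun x => _) = h 0 s) //.
  by apply/funext => x; rewrite /h expr0 mul1r.
under eq_integral do rewrite /= ger0_norm ?mulr_ge0 ?expR_ge0//.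
by rewrite mgf ltry.
Qed.

Let G x : R := expR (3 * l x) * g x + expR (- 3 * l x) * g x.

Let G_ge0 x : 0 <= G x.
Proof. by rewrite addr_ge0// mulr_ge0// expR_ge0. Qed.

Let G_integrable : mu.-integrable setT (EFin \o G).
Proof.
have := integrableD measurableT (exp_integrable 3) (exp_integrable (- 3)).
by apply: eq_integrable => // x _; rewrite /= EFinD.
Qed.

Let h_le k s x : (k <= 2)%N -> `|s| <= 1 -> `|h k s x| <= G x.
Proof.
move=> k2 s1; rewrite /h /G -mulrDl normrM (ger0_norm (g0 x)) ler_wpM2r//.
rewrite normrM normrX (ger0_norm (expR_ge0 _)).
apply: (@le_trans _ _ (expR (3 * `|l x|))); last first.
  have [l0|l0] := leP 0 (l x).
    by rewrite ger0_norm// lerDl expR_ge0.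
  by rewrite ltr0_norm// mulrN -mulNr lerDr expR_ge0.
rewrite (_ : 3 * `|l x| = 2 * `|l x| + `|l x|); last by ring.
rewrite expRD ler_pM ?exprn_ge0 ?expR_ge0//.
  have e1 : `|l x| <= expR `|l x|.
    by apply: le_trans (expR_ge1Dx _); rewrite lerDr.
  have e2 : 1 <= expR `|l x| by rewrite -expR0 ler_expR.
  apply: (@le_trans _ _ (expR `|l x| ^+ k)).
    by rewrite lerXn2r// nnegrE ?expR_ge0.
  apply: (@le_trans _ _ (expR `|l x| ^+ 2)).
    by rewrite ler_weXn2l.
  by rewrite -expRM_natl mulr_natl.
rewrite ler_expR (le_trans (ler_norm _))// normrM.
by rewrite -[leRHS]mul1r ler_wpM2r.
Qed.

Let h_integrable k s : (k <= 2)%N -> `|s| <= 1 ->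
  mu.-integrable setT (EFin \o h k s).
Proof.
move=> k2 s1; apply: le_integrable G_integrable => //.
  by apply/measurable_EFinP; exact: mh.
move=> x _; rewrite /= lee_fin.
by rewrite (ger0_norm (G_ge0 x)) h_le.
Qed.

Let h_derive k (s : R) x : is_derive s (1 : R) (h k ^~ x) (h k.+1 s x).
Proof.
have e : is_derive s (1 : R) (fun t => expR (t * l x)) (expR (s * l x) * l x).
  apply: (@is_derive1_comp _ expR (fun t => t * l x)).
  apply: is_derive_eq (is_derive_mul (is_derive_ident _ _) (is_derive_const _ _ _)) _.
  by rewrite mulr0 mulr1 add0r.
apply: is_derive_eq (is_derive_mul
  (is_derive_mul (is_derive_const (l x ^+ k) _ _) e) (is_derive_const (g x) _ _)) _.
by rewrite /h exprS; ring.
Qed.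

Let absb (a : R) : a \in `]-1, 1[ -> `|a| <= 1.
Proof. by rewrite in_itv /= => /andP[a1 a2]; rewrite ler_norml !ltW. Qed.

Let h_under k (a : R) : (k <= 1)%N -> a \in `]-1, 1[ ->
  is_derive a (1 : R) (fun s => \int[mu]_x h k s x) (\int[mu]_x h k.+1 a x).
Proof.
move=> k1 a1.
have hint x : [set` `](-1 : R), 1[] x -> mu.-integrable setT (EFin \o h k x).
  by move=> x1; apply: h_integrable; [exact: leqW|exact: absb].
have hder (x : R) y : [set` `](-1 : R), 1[] x -> setT y -> derivable (h k ^~ y) x 1.
  by move=> _ _; case: (h_derive k x y).
have hE s x : partial1of2 (h k) s x = h k.+1 s x.
  by rewrite partial1of2E; have [_ ->] := h_derive k s x.
have hub x y : [set` `](-1 : R), 1[] x -> setT y -> `|partial1of2 (h k) x y| <= G y.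
  by move=> x1 _; rewrite hE; apply: h_le => //; exact: absb.
apply: DeriveDef.
  exact: (derivable_under_integral measurableT a1 hint hder G_ge0 G_integrable hub).
rewrite -derive1E.
rewrite (differentiation_under_integral measurableT a1 hint hder G_ge0 G_integrable hub).
by under eq_Rintegral do rewrite hE.
Qed.

Let h0E : (fun s => \int[mu]_x h 0 s x) = (fun s => expR (s ^+ 2 * (q / 2))).
Proof.
apply/funext => s; rewrite /Rintegral.
under eq_integral do rewrite /h expr0 mul1r.
by rewrite mgf.
Qed.

Let h0_derive (s : R) :
  is_derive s (1 : R) (fun s => expR (s ^+ 2 * (q / 2))) (expR (s ^+ 2 * (q / 2)) * (s * q)).
Proof.
apply: (@is_derive1_comp _ expR (fun t => t ^+ 2 * (q / 2))).
apply: is_derive_eq (is_derive_mul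
   (is_derive_mul (is_derive_ident _ _) (is_derive_ident _ _)) (is_derive_const _ _ _)) _.
by field.
Qed.

Let h1E (a : R) : a \in `]-1, 1[ ->
  \int[mu]_x h 1 a x = expR (a ^+ 2 * (q / 2)) * (a * q).
Proof.
move=> a1; have [_ <-] := h_under (leq0n _) a1.
by rewrite h0E; have [_ ->] := h0_derive a.
Qed.

Let h2E : \int[mu]_x h 2 0 x = q.
Proof.
have z1 : (0 : R) \in `]-1, 1[ by rewrite in_itv /= ltr01 andbT oppr_lt0.
have [_ <-] := h_under (leqnn _) z1.
have e : \forall y \near (0 : R),
    \int[mu]_x h 1 y x = expR (y ^+ 2 * (q / 2)) * (y * q).
  have := near_in_itvoo z1; apply: filterS => y; exact: h1E.
rewrite (near_eq_derive _ e).
have := is_derive_mul (h0_derive 0)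
   (is_derive_mul (is_derive_ident 0 (1 : R)) (is_derive_const q _ _)).
case=> _ ->.
by rewrite !(mulr0, mul0r, add0r, addr0, expr0n, mulr1, mul1r, expR0).
Qed.

Lemma mgf_integrable1 : mu.-integrable setT (EFin \o (fun x => l x * g x)).
Proof.
have := @h_integrable 1 0 isT _; rewrite normr0 => /(_ ler01).
by apply: eq_integrable => // x _; rewrite /= /h mul0r expR0 mulr1 expr1.
Qed.

Lemma mgf_integrable2 : mu.-integrable setT (EFin \o (fun x => l x ^+ 2 * g x)).
Proof.
have := @h_integrable 2 0 isT _; rewrite normr0 => /(_ ler01).
by apply: eq_integrable => // x _; rewrite /= /h mul0r expR0 mulr1.
Qed.

Lemma mgf_moment1 : \int[mu]_x (l x * g x) = 0.
Proof.
have := h1E (_ : 0 \in _); rewrite in_itv /= ltr01 oppr_lt0 ltr01 => /(_ isT).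
rewrite mul0r mulr0 => e; rewrite -[RHS]e.
by apply: eq_Rintegral => x _; rewrite /h mul0r expR0 mulr1 expr1.
Qed.

Lemma mgf_moment2 : \int[mu]_x (l x ^+ 2 * g x) = q.
Proof.
rewrite -[RHS]h2E.
by apply: eq_Rintegral => x _; rewrite /h mul0r expR0 mulr1.
Qed.

End mgf.

Section gaussian.
Context {R : realType} {n : nat}.
Implicit Types (m : 'cV[R]_n) (C : 'M[R]_n).

Lemma gaussianE m C u : spd C ->
  gaussian m C u = ((2 * pi) `^ (n%:R / 2))^-1 * (\det C) `^ (- 2^-1) *
    expR (- 2^-1 * quad (invmx C) (u - m)).
Proof. by move=> spdC; rewrite /gaussian wnormE. Qed.

Lemma spd_det_gt0 C : spd C -> 0 < \det C.
Proof.
move=> spdC; have [S [spdS <-]] := spd_sqrt spdC.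
rewrite det_mulmx -expr2 lt_neqAle sqr_ge0 andbT eq_sym sqrf_eq0.
by have := spd_unit spdS; rewrite unitmxE unitfE.
Qed.

Lemma gaussian_ge0 m C u : 0 <= gaussian m C u.
Proof. by rewrite /gaussian !mulr_ge0 ?invr_ge0 ?powR_ge0 ?expR_ge0. Qed.

Lemma measurable_gaussian m C : spd C ->
  measurable_fun [set: n.-tuple (measurableTypeR R)] (gaussian m C \o col_of_tuple).
Proof.
move=> spdC; apply: (@eq_measurable_fun _ _ _ _ _ (fun x =>
   ((2 * pi) `^ (n%:R / 2))^-1 * (\det C) `^ (- 2^-1) *
    expR (- 2^-1 * quad (invmx C) (col_of_tuple x - m)))).
  by move=> x _; rewrite /= gaussianE.
apply: measurable_funM => //; apply: measurableT_comp => //.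
by apply: measurable_funM => //; exact: measurable_quad.
Qed.

Lemma gaussian_prefactorK C : spd C ->
  ((2 * pi) `^ (n%:R / 2))^-1 * (\det C) `^ (- 2^-1) *
  ((2 * pi) `^ (n%:R / 2) * (Num.sqrt (\det (invmx C)))^-1) = 1 :> R.
Proof.
move=> spdC; have dC := spd_det_gt0 spdC.
rewrite det_inv sqrtrV ?invrK ?ltW// -powR12_sqrt ?ltW// powRN.
have h1 : (2 * pi) `^ (n%:R / 2) != 0 :> R.
  by rewrite gt_eqF// powR_gt0// mulr_gt0// pi_gt0.
have h2 : (\det C) `^ 2^-1 != 0 by rewrite gt_eqF// powR_gt0.
by field; rewrite h1 h2.
Qed.

(** Multiplying by exp (s <a, u - m>) amounts, up to the factor
    exp (s^2 <a, C a> / 2), to moving the mean to m + s C a; so the formula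
    follows from the mass alone. *)
Lemma gaussian_mgf m C (a : 'rV[R]_n) s : spd C ->
  (\int[lebesgue_Rd n]_x
     (expR (s * (a *m (col_of_tuple x - m)) 0 0) * gaussian m C (col_of_tuple x))%:E
   = (expR (s ^+ 2 * ((a *m C *m a^T) 0 0 / 2)))%:E)%E.
Proof.
move=> spdC; have uC := spd_unit spdC; have spdV := spd_inv spdC.
pose b := C *m a^T.
have symV := proj1 spdV; have symC := proj1 spdC.
have quadB w : quad (invmx C) (w - s *: b) =
   quad (invmx C) w - 2 * s * (a *m w) 0 0 + s ^+ 2 * (a *m C *m a^T) 0 0.
  have bV : b^T *m invmx C = a by rewrite trmx_mul trmxK symC mulmxK.
  have Vb : invmx C *m b = a^T by rewrite mulKmx.
  have aw : (w^T *m a^T) 0 0 = (a *m w) 0 0 by rewrite -trmx_mul mxE.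
  have wT : (w - s *: b)^T = w^T - s *: b^T by rewrite linearB linearZ.
  rewrite /quad wT mulmxBl -scalemxAl bV mulmxBr !mulmxBl.
  rewrite -!scalemxAr -!scalemxAl -[w^T *m invmx C *m b]mulmxA Vb.
  have eB (X Y Z W : 'M[R]_1) : (X - Y - (Z - W)) 0 0 = X 0 0 - Y 0 0 - (Z 0 0 - W 0 0).
    by rewrite !mxE.
  have eZ (c : R) (X : 'M[R]_1) : (c *: X) 0 0 = c * X 0 0 by rewrite mxE.
  by rewrite eB !eZ aw /b mulmxA; ring.
have e x : expR (s * (a *m (col_of_tuple x - m)) 0 0) * gaussian m C (col_of_tuple x) =
    (((2 * pi) `^ (n%:R / 2))^-1 * (\det C) `^ (- 2^-1) *
       expR (s ^+ 2 * ((a *m C *m a^T) 0 0 / 2))) *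
    expR (- 2^-1 * quad (invmx C) (col_of_tuple x - (m + s *: b))).
  rewrite gaussianE// opprD addrA quadB mulrCA -!mulrA -!expRD; congr (_ * (_ * expR _)).
  by field.
under eq_integral do rewrite e EFinM.
rewrite ge0_integralZl//.
- rewrite gauss_mass// -EFinM mulrAC gaussian_prefactorK// mul1r //.
- apply/measurable_EFinP; apply: measurableT_comp => //.
  by apply: measurable_funM => //; exact: measurable_quad.
- by rewrite lee_fin !mulr_ge0 ?invr_ge0 ?powR_ge0 ?expR_ge0.
Qed.

Lemma pdensity_gaussian m C : spd C -> pdensity (gaussian m C).
Proof.
move=> spdC; split; [exact: gaussian_ge0|exact: measurable_gaussian|].
have := gaussian_mgf m 0 0 spdC; rewrite expr0n mul0r expR0 => <-.
by apply: eq_integral => x _; rewrite mul0r expR0 mul1r.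
Qed.

Section moments.
Variables (m : 'cV[R]_n) (C : 'M[R]_n) (spdC : spd C).
Let g (x : n.-tuple (measurableTypeR R)) := gaussian m C (col_of_tuple x).
Let mg : measurable_fun setT g. Proof. exact: measurable_gaussian. Qed.
Let g0 x : 0 <= g x. Proof. exact: gaussian_ge0. Qed.
Let lin (a : 'rV[R]_n) (x : n.-tuple (measurableTypeR R)) : R :=
  (a *m (col_of_tuple x - m)) 0 0.
Let ml a : measurable_fun setT (lin a). Proof. exact: measurable_lin. Qed.
Let mgfE a s := gaussian_mgf m a s spdC.

Let mom1i a :
  (lebesgue_Rd n).-integrable setT (EFin \o (fun x => lin a x * g x)).
Proof. exact: (mgf_integrable1 mg (ml a) g0 (mgfE a)). Qed.

Let mom2i a :
  (lebesgue_Rd n).-integrable setT (EFin \o (fun x => lin a x ^+ 2 * g x)).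
Proof. exact: (mgf_integrable2 mg (ml a) g0 (mgfE a)). Qed.

Let mom1 a : \int[lebesgue_Rd n]_x (lin a x * g x) = 0.
Proof. exact: (mgf_moment1 mg (ml a) g0 (mgfE a)). Qed.

Let mom2 a : \int[lebesgue_Rd n]_x (lin a x ^+ 2 * g x) = (a *m C *m a^T) 0 0.
Proof. exact: (mgf_moment2 mg (ml a) g0 (mgfE a)). Qed.

Let gi : (lebesgue_Rd n).-integrable setT (EFin \o g).
Proof.
apply/integrableP; split; first exact/measurable_EFinP.
under eq_integral do rewrite /= ger0_norm//.
by have [_ _ ->] := pdensity_gaussian m spdC; rewrite ltry.
Qed.

Let g1 : \int[lebesgue_Rd n]_x g x = 1.
Proof. by rewrite /Rintegral; have [_ _ ->] := pdensity_gaussian m spdC. Qed.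

Let erow i x : lin (delta_mx 0 i) x = col_of_tuple x i 0 - m i 0.
Proof. by rewrite /lin -rowE !mxE. Qed.

Lemma mean_gaussian : mean (gaussian m C) = m.
Proof.
apply/colP => i; rewrite mxE /int_Rd.
transitivity (\int[lebesgue_Rd n]_x
  (lin (delta_mx 0 i) x * g x + m i 0 * g x)).
  by apply: eq_Rintegral => x _; rewrite erow -mulrDl subrK.
rewrite RintegralD//; last exact: (integrableZl measurableT (m i 0) gi).
by rewrite mom1 RintegralZl// g1 mulr1 add0r.
Qed.

Lemma finite_second_moment_gaussian : finite_second_moment (gaussian m C).
Proof.
move=> i.
have h := integrableD measurableT (mom2i (delta_mx 0 i))
  (integrableD measurableT
    (integrableZl measurableT (2 * m i 0) (mom1i (delta_mx 0 i)))
    (integrableZl measurableT (m i 0 ^+ 2) gi)).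
apply: eq_integrable h => // x _.
rewrite /= -!EFinM -!EFinD erow; congr EFin.
by rewrite -/(g x); ring.
Qed.

(** Polarisation: the entry (i, j) is recovered from the variances along
    e_i + e_j, e_i and e_j. *)
Lemma covariance_gaussian : covariance_mx (gaussian m C) = C.
Proof.
apply/matrixP => i j; rewrite mxE mean_gaussian /int_Rd.
pose ei : 'rV[R]_n := delta_mx 0 i; pose ej : 'rV[R]_n := delta_mx 0 j.
pose L a x := lin a x ^+ 2 * g x.
transitivity (\int[lebesgue_Rd n]_x (2^-1 * L (ei + ej) x + (- 2^-1 * L ei x + - 2^-1 * L ej x))).
  apply: eq_Rintegral => x _.
  have linD : lin (ei + ej) x = lin ei x + lin ej x by rewrite /lin mulmxDl mxE.
  have -> : ((col_of_tuple x - m) *m (col_of_tuple x - m)^T) i j =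
      lin ei x * lin ej x by rewrite !erow !mxE big_ord1 !mxE.
  by rewrite /L linD -/(g x); field.
have iL a (c : R) : (lebesgue_Rd n).-integrable setT (EFin \o (fun x => c * L a x)).
  exact: (integrableZl measurableT c (mom2i a)).
have iLL a b (c e : R) : (lebesgue_Rd n).-integrable setT
    (EFin \o (fun x => c * L a x + e * L b x)).
  exact: (integrableD measurableT (iL a c) (iL b e)).
have iL1 a : (lebesgue_Rd n).-integrable setT (EFin \o L a) by exact: mom2i.
rewrite RintegralD// RintegralD// !RintegralZl// /L !mom2.
rewrite linearD /= !mulmxDl !mulmxDr.
have -> (X Y Z W : 'M[R]_1) : (X + Y + (Z + W)) 0 0 = X 0 0 + Y 0 0 + (Z 0 0 + W 0 0).
  by rewrite !mxE.
have dd k l : (delta_mx 0 k *m C *m (delta_mx 0 l)^T : 'M[R]_1) 0 0 = C k l.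
  by rewrite trmx_delta -colE mxE -rowE mxE.
rewrite /ei /ej !dd.
have -> : C j i = C i j by rewrite -[in LHS](proj1 spdC) mxE.
by field.
Qed.

End moments.
End gaussian.

(** * Limits and derivatives of matrix-valued functions *)

Section cvg_helpers.
Context {R : realType} {T : Type} {F : set_system T} {FF : Filter F}.

Lemma cvg_bigsum (I : Type) (r : seq I) (f : I -> T -> R) (l : I -> R) :
  (forall i, f i x @[x --> F] --> l i) ->
  \sum_(i <- r) f i x @[x --> F] --> \sum_(i <- r) l i.
Proof.
move=> fl; elim: r => [|i r IH].
  rewrite big_nil; under eq_fun do rewrite big_nil; exact: cvg_cst.
rewrite big_cons; under eq_fun do rewrite big_cons; exact: cvgD.
Qed.

Lemma cvg_bigprod (I : Type) (r : seq I) (f : I -> T -> R) (l : I -> R) :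
  (forall i, f i x @[x --> F] --> l i) ->
  \prod_(i <- r) f i x @[x --> F] --> \prod_(i <- r) l i.
Proof.
move=> fl; elim: r => [|i r IH].
  rewrite big_nil; under eq_fun do rewrite big_nil; exact: cvg_cst.
rewrite big_cons; under eq_fun do rewrite big_cons; exact: cvgM.
Qed.

(** Entrywise convergence: it combines directly with the scalar limit laws. *)
Definition mxcvg m n (M : T -> 'M[R]_(m, n)) (L : 'M[R]_(m, n)) :=
  forall i j, M x i j @[x --> F] --> L i j.

Lemma cvg_mxcvg m n (M : T -> 'M[R]_(m, n)) (L : 'M[R]_(m, n)) :
  M x @[x --> F] --> L -> mxcvg M L.
Proof.
move=> ML i j; have c := @coord_continuous R m n i j L.
exact: (cvg_comp M (fun N : 'M[R]_(m, n) => N i j) ML c).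
Qed.

Lemma mxcvg_cst m n (L : 'M[R]_(m, n)) : mxcvg (fun=> L) L.
Proof. by move=> i j; exact: cvg_cst. Qed.

Lemma mxcvgD m n (M N : T -> 'M[R]_(m, n)) (L K : 'M[R]_(m, n)) :
  mxcvg M L -> mxcvg N K -> mxcvg (fun x => M x + N x) (L + K).
Proof.
move=> ML NK i j; rewrite mxE; under eq_fun do rewrite mxE; exact: cvgD.
Qed.

Lemma mxcvgN m n (M : T -> 'M[R]_(m, n)) (L : 'M[R]_(m, n)) :
  mxcvg M L -> mxcvg (fun x => - M x) (- L).
Proof.
move=> ML i j; rewrite mxE; under eq_fun do rewrite mxE; exact: cvgN.
Qed.

Lemma mxcvgB m n (M N : T -> 'M[R]_(m, n)) (L K : 'M[R]_(m, n)) :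
  mxcvg M L -> mxcvg N K -> mxcvg (fun x => M x - N x) (L - K).
Proof. by move=> ML NK; apply: mxcvgD => //; exact: mxcvgN. Qed.

Lemma mxcvgZ m n (f : T -> R) (M : T -> 'M[R]_(m, n)) (a : R)
    (L : 'M[R]_(m, n)) :
  f x @[x --> F] --> a -> mxcvg M L -> mxcvg (fun x => f x *: M x) (a *: L).
Proof.
move=> fa ML i j; rewrite mxE; under eq_fun do rewrite mxE; exact: cvgM.
Qed.

Lemma mxcvgM m n p (M : T -> 'M[R]_(m, n)) (N : T -> 'M[R]_(n, p))
    (L : 'M[R]_(m, n)) (K : 'M[R]_(n, p)) :
  mxcvg M L -> mxcvg N K -> mxcvg (fun x => M x *m N x) (L *m K).
Proof.
move=> ML NK i j; rewrite mxE; under eq_fun do rewrite mxE.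
by apply: cvg_bigsum => k; exact: cvgM.
Qed.

Lemma mxcvgT m n (M : T -> 'M[R]_(m, n)) (L : 'M[R]_(m, n)) :
  mxcvg M L -> mxcvg (fun x => (M x)^T) L^T.
Proof.
move=> ML i j; rewrite mxE; under eq_fun do rewrite mxE; exact: ML.
Qed.

End cvg_helpers.
Arguments mxcvg {R T} F {m n} M L.

Section derive_mx.
Context {R : realType} {V : normedModType R}.
Implicit Types (x v : V).

Lemma is_derive_mx m n (M : V -> 'M[R]_(m, n)) x v (dM : 'M[R]_(m, n)) :
  is_derive x v M dM <->
  forall i j, is_derive x v (fun y => M y i j) (dM i j).
Proof.
split=> [[dv <-] i j|h].
  have /derivable_mxP dij := dv.
  by apply: DeriveDef => //; rewrite derive_mx// mxE.
have dv : derivable M x v by apply/derivable_mxP => i j; case: (h i j).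
apply: DeriveDef => //; rewrite derive_mx//; apply/matrixP => i j.
by rewrite mxE; case: (h i j).
Qed.

Lemma is_derive_bigsum (I : Type) (r : seq I) (f : I -> V -> R) (df : I -> R) x v :
  (forall i, is_derive x v (f i) (df i)) ->
  is_derive x v (fun y => \sum_(i <- r) f i y) (\sum_(i <- r) df i).
Proof.
move=> h; elim: r => [|i r IH].
  by rewrite big_nil; under eq_fun do rewrite big_nil; exact: is_derive_const.
rewrite big_cons; under eq_fun do rewrite big_cons.
exact: (is_deriveD (h i) IH).
Qed.

Lemma is_derive_add (f g : V -> R) (x v : V) (df dg : R) :
  is_derive x v f df -> is_derive x v g dg ->
  is_derive x v (fun y => f y + g y) (df + dg).
Proof. by move=> hf hg; exact: is_deriveD. Qed.

Lemma is_derive_sub (f g : V -> R) (x v : V) (df dg : R) :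
  is_derive x v f df -> is_derive x v g dg ->
  is_derive x v (fun y => f y - g y) (df - dg).
Proof. by move=> hf hg; exact: is_deriveB. Qed.

(** Chain rule for a directional derivative; differentiability of the inner
    function in all directions is what makes it hold. *)
Lemma is_derive_comp (f : R -> R) (g : V -> R) x v (a b : R) :
  is_derive (g x) (1 : R) f a -> differentiable g x -> is_derive x v g b ->
  is_derive x v (fun y => f (g y)) (a * b).
Proof.
move=> [df da] dg [_ db].
have dfd : differentiable f (g x) by apply/derivable1_diffP.
have dfg : differentiable (f \o g) x by exact: differentiable_comp.
apply: DeriveDef; first exact: diff_derivable.
rewrite deriveE// diff_comp//= (deriv1E df) derive1E da.
by rewrite -(deriveE _ dg) db /GRing.scale /= mulrC.
Qed.

Lemma is_derive_mulmx m n p (M : V -> 'M[R]_(m, n)) (N : V -> 'M[R]_(n, p))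
    x v (dM : 'M[R]_(m, n)) (dN : 'M[R]_(n, p)) :
  is_derive x v M dM -> is_derive x v N dN ->
  is_derive x v (fun y => M y *m N y) (dM *m N x + M x *m dN).
Proof.
move=> /is_derive_mx hM /is_derive_mx hN; apply/is_derive_mx => i j.
rewrite mxE 2![in X in is_derive _ _ _ X]mxE -big_split /=.
under eq_fun do rewrite mxE.
apply: is_derive_bigsum => k.
by apply: is_derive_eq (is_derive_mul (hM i k) (hN k j)) _; ring.
Qed.

Lemma is_derive_prod (I : Type) (r : seq I) (f : I -> V -> R) (df : I -> R) x v :
  (forall i, f i x != 0) ->
  (forall i, is_derive x v (f i) (df i)) ->
  is_derive x v (fun y => \prod_(i <- r) f i y)
    (\prod_(i <- r) f i x * \sum_(i <- r) df i / f i x).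
Proof.
move=> f0 h; elim: r => [|i r IH].
  rewrite !big_nil mulr0; under eq_fun do rewrite big_nil.
  exact: is_derive_const.
rewrite !big_cons; under eq_fun do rewrite big_cons.
by apply: is_derive_eq (is_derive_mul (h i) IH) _; field.
Qed.

End derive_mx.

(** * Gronwall's inequality and linear differential equations *)

Section gronwall.
Context {R : realType}.

(** The function t |-> e^(-k t) f t is nonincreasing on [0, T].  The constant
    [k] may have either sign; a negative one gives exponential decay. *)
Lemma gronwall (f df : R -> R) (k T : R) : 0 < T ->
  {within `[0, T], continuous f} ->
  (forall t : R, 0 < t -> is_derive t (1 : R) f (df t)) ->
  (forall t, t \in `]0, T[ -> df t <= k * f t) ->
  f T <= expR (k * T) * f 0.
Proof.
move=> T0 cf hf dfk.
pose h t := expR (- k * t) * f t.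
have hh (t : R) : 0 < t ->
    is_derive t (1 : R) h (expR (- k * t) * (df t - k * f t)).
  move=> t0.
  have e : is_derive t (1 : R) (fun s => expR (- k * s)) (expR (- k * t) * - k).
    apply: (@is_derive1_comp _ expR (fun t => - k * t)).
    apply: is_derive_eq (is_derive_mul (is_derive_const _ _ _) (is_derive_ident _ _)) _.
    by ring.
  by apply: is_derive_eq (is_derive_mul e (hf t t0)) _; ring.
have ch : {within `[0, T], continuous h}.
  move=> x; apply: cvgM; last exact: cf.
  apply: continuous_subspaceT => y.
  apply: continuous_comp; last exact: continuous_expR.
  by apply: cvgM; [exact: cvg_cst|exact: cvg_id].
have gt0 x : x \in `]0, T[ -> 0 < x by rewrite in_itv => /andP[].
have : h T <= h 0.
  apply: (@ler0_derive1_le_cc _ h 0 T) => //.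
  - by move=> x /gt0/hh[].
  - move=> x xT; have [_ e] := hh x (gt0 x xT).
    by rewrite derive1E e pmulr_rle0 ?expR_gt0// subr_le0 dfk.
  - by rewrite in_itv /= lexx ltW.
  - by rewrite in_itv /= lexx ltW.
  - exact: ltW.
rewrite /h mulr0 expR0 mul1r mulNr expRN => h1.
by rewrite -ler_pdivrMl ?expR_gt0.
Qed.

Lemma is_derive_within_continuous (f df : R -> R) (T : R) : 0 < T ->
  (forall t : R, 0 < t -> is_derive t (1 : R) f (df t)) ->
  f t @[t --> 0^'+] --> f 0 -> {within `[0, T], continuous f}.
Proof.
move=> T0 hf f0.
have ct (t : R) : 0 < t -> {for t, continuous f}.
  move=> t0; apply: differentiable_continuous; apply/derivable1_diffP.
  by case: (hf t t0).
apply/continuous_within_itvP => //; split => //.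
- by move=> t; rewrite in_itv => /andP[t0 _]; exact: ct.
- exact/cvg_at_left_filter/ct.
Qed.

End gronwall.

Section linear_ode.
Context {R : realType} {n : nat}.

(** The sum f of the squared entries of [D] satisfies f' <= K f on [0, T],
    where [K] comes from the maximum on that interval of the sum of the absolute
    values of the entries of [L]. *)
Lemma linear_ode_zero (D L : R -> 'M[R]_n) :
  (forall t : R, 0 < t -> is_derive t (1 : R) D (D t *m L t)) ->
  mxcvg 0^'+ D (D 0) -> D 0 = 0 ->
  (forall (T : R) i j, 0 < T -> {within `[0, T], continuous (fun t => L t i j)}) ->
  forall t, 0 <= t -> D t = 0.
Proof.
move=> dD D0c D0 Lc T; rewrite le_eqVlt => /predU1P[<-//|T0].
pose f t := \sum_i \sum_j D t i j ^+ 2.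
pose df t := \sum_i \sum_j 2 * D t i j * (D t *m L t) i j.
have hf (t : R) : 0 < t -> is_derive t (1 : R) f (df t).
  move=> t0; have /is_derive_mx h := dD t t0.
  apply: is_derive_bigsum => i; apply: is_derive_bigsum => j.
  by apply: is_derive_eq (is_derive_mul (h i j) (h i j)) _; ring.
have fc : f t @[t --> 0^'+] --> f 0.
  by apply: cvg_bigsum => i; apply: cvg_bigsum => j; exact: cvgM.
have f_ge t i j : D t i j ^+ 2 <= f t.
  rewrite /f (bigD1 i)//= (bigD1 j)//= -addrA lerDl addr_ge0//.
    by rewrite sumr_ge0// => k _; rewrite sqr_ge0.
  by rewrite sumr_ge0// => k _; rewrite sumr_ge0// => l _; rewrite sqr_ge0.
pose kap t := \sum_k \sum_j `|L t k j|.
have kapc : {within `[0, T], continuous kap}.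
  move=> x; apply: cvg_bigsum => k; apply: cvg_bigsum => j.
  by apply: cvg_norm; exact: Lc.
have [c _ kc] := EVT_max (ltW T0) kapc.
have L_le t k j : t \in `[0, T] -> `|L t k j| <= kap c.
  move=> /kc; apply: le_trans.
  rewrite /kap (bigD1 k)//= (bigD1 j)//= -addrA lerDl addr_ge0//.
    by rewrite sumr_ge0.
  by rewrite sumr_ge0// => ? _; rewrite sumr_ge0.
pose K : R := \sum_(i < n) \sum_(j < n) \sum_(k < n) 2 * kap c.
have dfK t : t \in `]0, T[ -> df t <= K * f t.
  move=> /subset_itv_oo_cc tT.
  rewrite /df /K mulr_suml ler_sum// => i _; rewrite mulr_suml ler_sum// => j _.
  rewrite mxE mulr_sumr mulr_suml ler_sum// => k _.
  have fi := f_ge t i k; have fj := f_ge t i j; have Lk := L_le t k j tT.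
  apply: (le_trans (ler_norm _)); rewrite 3!normrM normr_nat -!mulrA ler_wpM2l//.
  (* a b <= (a^2 + b^2) / 2 <= f, where a and b are |D_ij| and |D_ik| *)
  rewrite mulrA mulrC; apply: ler_pM => //.
  rewrite -(ger0_norm (le_trans (sqr_ge0 (D t i j)) fj)).
  have : (`|D t i j| - `|D t i k|) ^+ 2 >= 0 by exact: sqr_ge0.
  rewrite -(real_normK (num_real (D t i j))) in fj.
  rewrite -(real_normK (num_real (D t i k))) in fi.
  move: (`|D t i j|) (`|D t i k|) fi fj => a b fi fj h.
  have f0 : 0 <= f t by apply: le_trans fi; exact: sqr_ge0.
  by rewrite (ger0_norm f0); nra.
have := gronwall T0 (is_derive_within_continuous T0 hf fc) hf dfK.
rewrite {2}/f D0 big1 ?mulr0 => [fT|i _]; last first.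
  by rewrite big1// => j _; rewrite mxE expr0n.
apply/matrixP => i j; rewrite mxE; apply/eqP; rewrite -sqrf_eq0 eq_le sqr_ge0 andbT.
exact: le_trans (f_ge T i j) fT.
Qed.

End linear_ode.

(** * The covariance equation in terms of the precision *)

Section precision.
Context {R : realType} {n : nat}.
Variables (Bi P0 : 'M[R]_n).
Hypotheses (spdBi : spd Bi) (spdP0 : spd P0).

Definition decay (t : R) : R := expR (- 2 * t).

(** The solution of Q' = 2 (Bi - Q), Q 0 = P0. *)
Definition precision (t : R) : 'M[R]_n := (1 - decay t) *: Bi + decay t *: P0.

Lemma decay_gt0 t : 0 < decay t. Proof. exact: expR_gt0. Qed.

Lemma decay_le1 t : 0 <= t -> decay t <= 1.
Proof. by move=> t0; rewrite /decay -[leRHS]expR0 ler_expR; lra. Qed.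

Lemma decay0 : decay 0 = 1. Proof. by rewrite /decay mulr0 expR0. Qed.

Lemma is_derive_decay (t : R) : is_derive t (1 : R) decay (- 2 * decay t).
Proof.
have h : is_derive t (1 : R) (fun s : R => - 2 * s) (- 2).
  apply: is_derive_eq (is_derive_mul (is_derive_const _ _ _) (is_derive_ident _ _)) _.
  by ring.
by apply: is_derive_eq (is_derive1_comp (is_derive_expR _) h) _; rewrite mulrC.
Qed.

Lemma cvg_decay : decay t @[t --> +oo] --> (0 : R).
Proof.
rewrite -[X in _ --> X](mulr0 (0 : R)).
rewrite (_ : decay = fun t => expR (- t) * expR (- t)); last first.
  by apply/funext => t; rewrite -expRD /decay; congr expR; ring.
by apply: cvgM; exact: cvgr_expR.
Qed.

Lemma precision0 : precision 0 = P0.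
Proof. by rewrite /precision decay0 subrr scale0r add0r scale1r. Qed.

Lemma spd_precision t : 0 <= t -> spd (precision t).
Proof.
move=> t0; apply: psd_spd_add; last exact: spd_scale (decay_gt0 t) spdP0.
  by rewrite linearZ /= (proj1 spdBi).
move=> a; rewrite -scalemxAr -scalemxAl mxE mulr_ge0 ?spd_psd//.
by rewrite subr_ge0 decay_le1.
Qed.

Lemma is_derive_precision (t : R) :
  is_derive t (1 : R) precision (2 *: (Bi - precision t)).
Proof.
apply/is_derive_mx => i j.
rewrite (_ : (fun y => precision y i j) =
   fun y => (1 - decay y) * Bi i j + decay y * P0 i j); last first.
  by apply/funext => y; rewrite !mxE.
apply: is_derive_eq (is_derive_add
  (is_derive_mul (is_derive_sub (is_derive_const _ _ _) (is_derive_decay t))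
     (is_derive_const _ _ _))
  (is_derive_mul (is_derive_decay t) (is_derive_const _ _ _))) _.
by rewrite !mxE; ring.
Qed.

Lemma is_derive_continuous (V : normedModType R) (f : R -> V) (t : R) df :
  is_derive t (1 : R) f df -> f x @[x --> t] --> f t.
Proof.
by move=> [h _]; apply: differentiable_continuous; exact/derivable1_diffP.
Qed.

Lemma cvg_precision : mxcvg +oo precision Bi.
Proof.
rewrite -[X in mxcvg _ _ X]addr0 -[X in X + _]scale1r -(scale0r P0) -[1]subr0.
apply: mxcvgD; apply: mxcvgZ; try exact: mxcvg_cst; try exact: cvg_decay.
by apply: cvgB; [exact: cvg_cst|exact: cvg_decay].
Qed.

(** D = Q C - 1 satisfies D' = D (-2 Bi C) and D 0 = 0.  The coefficient
    -2 Bi C is continuous on every [0, T], as [linear_ode_zero] requires. *)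
Lemma precision_unique (C : R -> 'M[R]_n) :
  C t @[t --> 0^'+] --> C 0 -> P0 *m C 0 = 1%:M ->
  (forall t : R, 0 < t ->
     is_derive t (1 : R) C (- 2 *: (C t *m Bi *m C t) + 2 *: C t)) ->
  forall t, 0 <= t -> precision t *m C t = 1%:M.
Proof.
move=> C0c PC0 dC t t0; apply/subr0_eq.
pose L s := - 2 *: (Bi *m C s).
have Cc : mxcvg 0^'+ C (C 0) := cvg_mxcvg C0c.
have PC : mxcvg 0^'+ precision (precision 0).
  apply: cvg_mxcvg; apply: cvg_at_right_filter.
  exact: is_derive_continuous (is_derive_precision 0).
apply: (@linear_ode_zero _ _ (fun s => precision s *m C s - 1%:M) L) => //.
- move=> s s0.
  have h := is_derive_mulmx (is_derive_precision s) (dC s s0).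
  have := @is_deriveB _ _ _ _ _ _ _ _ _ h (is_derive_cst (1%:M : 'M[R]_n) s 1).
  move/is_derive_eq; apply.
  rewrite subr0 /L -scalemxAr mulmxBl mul1mx -scalemxAl mulmxBl mulmxDr.
  rewrite -!scalemxAr !mulmxA.
  move: (Bi *m C s) (_ *m C s) (_ *m Bi *m C s) => X Y Z.
  by apply/matrixP => i j; rewrite !mxE; ring.
- apply: mxcvgB; last exact: mxcvg_cst.
  exact: mxcvgM.
- by rewrite precision0 PC0 subrr.
- move=> T i j T0; rewrite /L.
  apply: (@is_derive_within_continuous _ _
    (fun s => (- 2 *: (Bi *m (- 2 *: (C s *m Bi *m C s) + 2 *: C s))) i j)) => //.
    move=> s s0; have /is_derive_mx h := dC s s0.
    rewrite (_ : (fun t0 => _) = fun s => - 2 * \sum_k Bi i k * C s k j); last first.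
      by apply/funext => u; rewrite !mxE.
    apply: is_derive_eq (is_derive_mul (is_derive_const _ _ _)
      (is_derive_bigsum _ (fun k => is_derive_mul (is_derive_const (Bi i k) _ _) (h k j)))) _.
    rewrite mulr0 addr0 [RHS]mxE [in RHS]mxE; congr (_ * _).
    by apply: eq_bigr => k _; rewrite mulr0 addr0.
  apply: mxcvgZ; first exact: cvg_cst.
  by apply: mxcvgM => //; exact: mxcvg_cst.
Qed.

End precision.

(** * The mean equation in simultaneously diagonalising coordinates *)

Section diagonal.
Context {R : realType} {n : nat}.
Variables (Bi P0 G : 'M[R]_n) (lam : 'rV[R]_n).
Hypotheses (spdBi : spd Bi) (spdP0 : spd P0) (uG : G \in unitmx).
Hypotheses (P0E : P0 = G^T *m G) (BiE : Bi = G^T *m diag_mx lam *m G).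

(** The diagonal entries of the precision in the coordinates given by [G]. *)
Definition prec_diag (t : R) : 'rV[R]_n :=
  \row_i ((1 - decay t) * lam 0 i + decay t).

Lemma eigenvalue_gt0 i : 0 < lam 0 i.
Proof.
move: i; apply/spd_diag.
have uV : invmx G \in unitmx by rewrite unitmx_inv.
have := spd_congr_unit spdBi uV.
rewrite BiE !mulmxA -trmx_mul mulmxV// trmx1 mul1mx -mulmxA mulmxV//.
by rewrite mulmx1.
Qed.

Lemma precision_diag t : precision Bi P0 t = G^T *m diag_mx (prec_diag t) *m G.
Proof.
have -> : diag_mx (prec_diag t) = (1 - decay t) *: diag_mx lam + decay t *: 1%:M.
  apply/matrixP => i j; rewrite !mxE.
  by case: (_ == _); rewrite ?(mulr1n, mulr0n) /=; ring.
rewrite mulmxDr mulmxDl -!scalemxAr -!scalemxAl mulmx1.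
by rewrite /precision -BiE -P0E.
Qed.

Lemma prec_diag_ge t i : 0 <= t -> Num.min 1 (lam 0 i) <= prec_diag t 0 i.
Proof.
move=> t0; rewrite mxE; have e0 := decay_gt0 t; have e1 := decay_le1 t0.
set d := Num.min _ _; have d1 : d <= 1 by rewrite ge_min lexx.
have dl : d <= lam 0 i by rewrite ge_min lexx orbT.
nra.
Qed.

Lemma min_eigenvalue_gt0 i : 0 < Num.min 1 (lam 0 i).
Proof. by rewrite lt_min ltr01 eigenvalue_gt0. Qed.

Lemma prec_diag_gt0 t i : 0 <= t -> 0 < prec_diag t 0 i.
Proof. by move=> t0; exact: lt_le_trans (min_eigenvalue_gt0 i) (prec_diag_ge i t0). Qed.

Lemma prec_diag0 i : prec_diag 0 0 i = 1.
Proof. by rewrite mxE decay0 subrr mul0r add0r. Qed.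

Lemma is_derive_prec_diag (t : R) i :
  is_derive t (1 : R) (fun s => prec_diag s 0 i) (2 * (lam 0 i - prec_diag t 0 i)).
Proof.
under eq_fun do rewrite mxE.
apply: is_derive_eq (is_derive_add
  (is_derive_mul (is_derive_sub (is_derive_const _ _ _) (is_derive_decay t))
     (is_derive_const _ _ _)) (is_derive_decay t)) _.
by rewrite !mxE; ring.
Qed.

Section mean_decay.
Variables (C : R -> 'M[R]_n) (w : R -> 'cV[R]_n).
Hypothesis (PC : forall t, 0 <= t -> precision Bi P0 t *m C t = 1%:M).
Hypothesis (w0 : mxcvg 0^'+ w (w 0)).
Hypothesis (dw : forall t : R, 0 < t -> is_derive t (1 : R) w (- (C t *m (Bi *m w t)))).

Let z t := G *m w t.

Let dz (t : R) i : 0 < t -> exists2 dz, is_derive t (1 : R) (fun s => z s i 0) dz &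
  prec_diag t 0 i * dz = - lam 0 i * z t i 0.
Proof.
move=> t0; exists ((G *m - (C t *m (Bi *m w t))) i 0).
  have h := is_derive_mulmx (is_derive_cst G t (1 : R)) (dw t0).
  have {}h : is_derive t (1 : R) z (G *m - (C t *m (Bi *m w t))).
    by move/is_derive_eq: h; apply; rewrite mul0mx add0r.
  by have /is_derive_mx := h.
have DC : diag_mx (prec_diag t) *m G *m C t *m G^T = 1%:M.
  apply: mulmx1C; have := PC (ltW t0).
  by rewrite precision_diag !mulmxA.
transitivity ((diag_mx (prec_diag t) *m (G *m - (C t *m (Bi *m w t)))) i 0).
  by rewrite mul_diag_mx mxE.
rewrite !mulmxN BiE -!mulmxA !mulmxA DC mul1mx.
by rewrite -mulmxA mul_diag_mx !mxE mulNr.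
Qed.

(** The quantity d_i z_i^2 has derivative -2 d_i z_i^2, because
    d_i' = 2 (lam_i - d_i) and d_i z_i' = - lam_i z_i; [gronwall] applies with
    k = -2. *)
Lemma deviation_energy t i : 0 <= t ->
  prec_diag t 0 i * z t i 0 ^+ 2 <= decay t * z 0 i 0 ^+ 2.
Proof.
rewrite le_eqVlt => /predU1P[<-|t0]; first by rewrite decay0 prec_diag0.
pose f s := prec_diag s 0 i * z s i 0 ^+ 2.
have hf (s : R) : 0 < s -> is_derive s (1 : R) f (- 2 * f s).
  move=> s0; have [e h he] := dz i s0.
  apply: is_derive_eq (is_derive_mul (is_derive_prec_diag s i) (is_derive_mul h h)) _.
  rewrite -mulr2n -mulrnAr -[e *+ 2]mulr_natr.
  transitivity (2 * z s i 0 * (prec_diag s 0 i * e) +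
    z s i 0 ^+ 2 * (2 * (lam 0 i - prec_diag s 0 i))).
    by rewrite expr2; ring.
  by rewrite he /f; ring.
have fc : f s @[s --> 0^'+] --> f 0.
  have zc : z s i 0 @[s --> 0^'+] --> z 0 i 0.
    by apply: mxcvgM => //; exact: mxcvg_cst.
  apply: cvgM; last exact: cvgM.
  apply: cvg_at_right_filter.
  exact: is_derive_continuous (is_derive_prec_diag 0 i).
have := gronwall t0 (is_derive_within_continuous t0 hf fc) hf (fun s _ => lexx _).
by rewrite {2}/f prec_diag0 mul1r.
Qed.

(** [deviation_energy] bounds z_i^2 by a multiple of e^(-2t), since
    d_i >= min (1, lam_i) > 0. *)
Lemma cvg_deviation0 : mxcvg +oo w 0.
Proof.
have zc : mxcvg +oo z 0.
  move=> i j; rewrite ord1 mxE {j}.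
  pose k := z 0 i 0 ^+ 2 / Num.min 1 (lam 0 i).
  have z2 : z t i 0 ^+ 2 @[t --> +oo] --> (0 : R).
    apply: (@squeeze_cvgr _ _ _ _ (cst 0) (fun t => decay t * k)).
    - near=> t.
      have t0 : 0 <= t by near: t; exact: nbhs_pinfty_ge.
      rewrite sqr_ge0 /= /k mulrA ler_pdivlMr ?min_eigenvalue_gt0//.
      apply: le_trans (deviation_energy i t0); rewrite mulrC.
      by rewrite ler_wpM2r ?sqr_ge0// prec_diag_ge.
    - exact: cvg_cst.
    - rewrite -[X in _ --> X](mul0r k).
      by apply: cvgM; [exact: cvg_decay|exact: cvg_cst].
  apply: norm_cvg0.
  rewrite (_ : (fun t => `|z t i 0|) = Num.sqrt \o (fun t => z t i 0 ^+ 2)); last first.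
    by apply/funext => t /=; rewrite sqrtr_sqr.
  rewrite -[X in _ --> X]sqrtr0.
  exact: (cvg_comp _ _ z2 (@sqrt_continuous R 0)).
rewrite -[X in mxcvg _ _ X](mulmx0 _ (invmx G)).
rewrite (_ : w = fun t => invmx G *m z t); last first.
  by apply/funext => t; rewrite /z mulKmx.
by apply: mxcvgM => //; exact: mxcvg_cst.
Unshelve. all: by end_near.
Qed.

End mean_decay.

Section existence.
Variables (C0 : 'M[R]_n) (w0 : 'cV[R]_n).
Hypothesis (PC0 : P0 *m C0 = 1%:M).

Let Gi := invmx G.
Let dC t := \row_i (prec_diag t 0 i)^-1.
Let dm t := \row_i (expR (- t) / Num.sqrt (prec_diag t 0 i)).
Let C t := Gi *m diag_mx (dC t) *m Gi^T.
Let w t := Gi *m diag_mx (dm t) *m (G *m w0).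

Let is_derive_diag (t : R) (e : R -> 'rV[R]_n) (de : 'rV[R]_n) :
  (forall i, is_derive t (1 : R) (fun s => e s 0 i) (de 0 i)) ->
  is_derive t (1 : R) (fun s => diag_mx (e s)) (diag_mx de).
Proof.
move=> h; apply/is_derive_mx => i j; rewrite mxE; under eq_fun do rewrite mxE.
case: (i == j) => /=; first exact: h.
by under eq_fun do rewrite mulr0n; exact: is_derive_const.
Qed.

Let dC_derive (t : R) : 0 <= t -> is_derive t (1 : R) C
  (Gi *m diag_mx (\row_i (2 * (prec_diag t 0 i - lam 0 i) / prec_diag t 0 i ^+ 2)) *m Gi^T).
Proof.
move=> t0.
have h : is_derive t (1 : R) (fun s => diag_mx (dC s))
   (diag_mx (\row_i (2 * (prec_diag t 0 i - lam 0 i) / prec_diag t 0 i ^+ 2))).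
  apply: is_derive_diag => i; rewrite mxE; under eq_fun do rewrite mxE.
  have d0 : prec_diag t 0 i != 0 by rewrite gt_eqF// prec_diag_gt0.
  apply: is_derive_eq (is_deriveV d0 (is_derive_prec_diag t i)) _.
  by rewrite /GRing.scale /=; field.
have h1 := is_derive_mulmx (is_derive_mulmx (is_derive_cst Gi t (1 : R)) h)
   (is_derive_cst Gi^T t (1 : R)).
by move/is_derive_eq: h1; apply; rewrite mulmx0 addr0 mul0mx add0r.
Qed.

Let dw_derive (t : R) : 0 <= t -> is_derive t (1 : R) w
  (Gi *m diag_mx (\row_i (- (lam 0 i / prec_diag t 0 i) * dm t 0 i)) *m (G *m w0)).
Proof.
move=> t0.
have h : is_derive t (1 : R) (fun s => diag_mx (dm s))
   (diag_mx (\row_i (- (lam 0 i / prec_diag t 0 i) * dm t 0 i))).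
  apply: is_derive_diag => i; rewrite mxE [dm t 0 i]mxE; under eq_fun do rewrite mxE.
  have d0 := prec_diag_gt0 i t0.
  have s0 : Num.sqrt (prec_diag t 0 i) != 0 by rewrite gt_eqF// sqrtr_gt0.
  have hs := is_derive1_comp (is_derive1_sqrt d0) (is_derive_prec_diag t i).
  have he : is_derive t (1 : R) (fun s => expR (- s)) (expR (- t) * - 1).
    apply: (@is_derive1_comp _ expR (fun s => - s)).
  have hV := @is_deriveV _ (fun s => Num.sqrt (prec_diag s 0 i)) _ _ _ s0 hs.
  apply: is_derive_eq (is_derive_mul he hV) _.
  rewrite /= /GRing.scale /=.
  have e2 : prec_diag t 0 i = Num.sqrt (prec_diag t 0 i) ^+ 2 by rewrite sqr_sqrtr// ltW.
  move: (Num.sqrt (prec_diag t 0 i)) e2 s0 => x -> x0.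
  by field.
have h1 := is_derive_mulmx (is_derive_mulmx (is_derive_cst Gi t (1 : R)) h)
   (is_derive_cst (G *m w0) t (1 : R)).
by move/is_derive_eq: h1; apply; rewrite mulmx0 addr0 mul0mx add0r.
Qed.

Let GTiV : Gi^T *m G^T = 1%:M.
Proof. by rewrite -trmx_mul mulmxV// trmx1. Qed.

(** In the coordinates z = G w the solution is diagonal: the covariance has
    entries 1 / d_i and the deviation is multiplied by e^(-t) / sqrt d_i, whose
    logarithmic derivative is -1 - (lam_i - d_i) / d_i = - lam_i / d_i. *)
Lemma moment_odes_explicit : exists C : R -> 'M[R]_n, exists w : R -> 'cV[R]_n,
  [/\ C 0 = C0 /\ C t @[t --> 0^'+] --> C0,
      w 0 = w0 /\ w t @[t --> 0^'+] --> w0,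
      forall t : R, 0 < t ->
        is_derive t (1 : R) C (- 2 *: (C t *m Bi *m C t) + 2 *: C t) &
      forall t : R, 0 < t ->
        is_derive t (1 : R) w (- (C t *m (Bi *m w t)))].
Proof.
have dC0 : diag_mx (dC 0) = 1%:M.
  rewrite -diag_const_mx; congr diag_mx; apply/rowP => i.
  by rewrite !mxE decay0 subrr mul0r add0r invr1.
have dm0 : diag_mx (dm 0) = 1%:M.
  rewrite -diag_const_mx; congr diag_mx; apply/rowP => i.
  by rewrite !mxE decay0 subrr mul0r add0r sqrtr1 divr1 oppr0 expR0.
have C00 : C 0 = C0.
  rewrite /C dC0 mulmx1 -[RHS]mul1mx -[X in _ = X *m _](_ : Gi *m Gi^T *m P0 = _).
    by rewrite -mulmxA PC0 mulmx1.
  by rewrite P0E -mulmxA [Gi^T *m _]mulmxA GTiV mul1mx mulVmx.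
have w00 : w 0 = w0 by rewrite /w dm0 mulmx1 mulKmx.
have CBi t : C t *m Bi = Gi *m (diag_mx (dC t) *m diag_mx lam) *m G.
  by rewrite /C BiE -!mulmxA [Gi^T *m _]mulmxA GTiV mul1mx.
exists C, w; split.
- split=> //; rewrite -C00; apply: cvg_at_right_filter.
  exact: is_derive_continuous (dC_derive (lexx 0)).
- split=> //; rewrite -w00; apply: cvg_at_right_filter.
  exact: is_derive_continuous (dw_derive (lexx 0)).
- move=> t t0; apply: is_derive_eq (dC_derive (ltW t0)) _.
  have -> : C t *m Bi *m C t =
      Gi *m (diag_mx (dC t) *m diag_mx lam *m diag_mx (dC t)) *m Gi^T.
    by rewrite CBi /C !mulmxA mulmxK.
  have lin (a : R) X : a *: (Gi *m X *m Gi^T) = Gi *m (a *: X) *m Gi^T.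
    by rewrite -scalemxAr -scalemxAl.
  rewrite /C !lin -mulmxDl -mulmxDr !mulmx_diag.
  congr (_ *m _ *m _); apply/matrixP => i j; rewrite !mxE.
  have /gt_eqF := prec_diag_gt0 i (ltW t0); rewrite mxE => /negbT d0.
  by case: (i == j); rewrite ?(mulr1n, mulr0n) /=; [field|ring].
- move=> t t0; apply: is_derive_eq (dw_derive (ltW t0)) _.
  have -> : C t *m (Bi *m w t) =
      Gi *m (diag_mx (dC t) *m diag_mx lam *m diag_mx (dm t)) *m (G *m w0).
    by rewrite mulmxA CBi /w !mulmxA mulmxK.
  rewrite -mulNmx -mulmxN !mulmx_diag.
  congr (_ *m _ *m _); apply/matrixP => i j; rewrite !mxE.
  have /gt_eqF := prec_diag_gt0 i (ltW t0); rewrite mxE => /negbT d0.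
  by case: (i == j); rewrite ?(mulr1n, mulr0n) /=; ring.
Qed.
End existence.
End diagonal.

(** * Space derivatives of a Gaussian profile *)

Section quad_facts.
Context {R : realType} {n : nat}.
Implicit Types (P : 'M[R]_n) (w v : 'cV[R]_n).

Lemma quadE P w : quad P w = \sum_i \sum_j P i j * w i 0 * w j 0.
Proof.
rewrite /quad -mulmxA mxE; apply: eq_bigr => i _.
by rewrite !mxE mulr_sumr; apply: eq_bigr => j _; rewrite mulrCA mulrA.
Qed.

Lemma bilin_sym P v w : P^T = P -> (v^T *m P *m w) 0 0 = (w^T *m P *m v) 0 0.
Proof.
move=> sP; have <- : (w^T *m P *m v)^T = v^T *m P *m w.
  by rewrite !trmx_mul trmxK sP mulmxA.
by rewrite [LHS]mxE.
Qed.

Lemma evec_dot i w : ((evec i)^T *m w) 0 0 = w i 0.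
Proof. by rewrite /evec trmx_delta -rowE mxE. Qed.

End quad_facts.

Section space_calculus.
Context {R : realType} {V : normedModType R}.

Lemma is_derive_trmx m n (M : V -> 'M[R]_(m, n)) x v (dM : 'M[R]_(m, n)) :
  is_derive x v M dM -> is_derive x v (fun y => (M y)^T) dM^T.
Proof.
move=> /is_derive_mx h; apply/is_derive_mx => i j; rewrite mxE.
by under eq_fun do rewrite mxE.
Qed.

Lemma is_derive_quad n (Q : V -> 'M[R]_n) (w : V -> 'cV[R]_n) x v
    (dQ : 'M[R]_n) (dw : 'cV[R]_n) : (Q x)^T = Q x ->
  is_derive x v Q dQ -> is_derive x v w dw ->
  is_derive x v (fun y => quad (Q y) (w y))
    (quad dQ (w x) + 2 * ((w x)^T *m Q x *m dw) 0 0).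
Proof.
move=> sQ hQ hw.
have /is_derive_mx := is_derive_mulmx (is_derive_mulmx (is_derive_trmx hw) hQ) hw.
move=> /(_ 0 0) /is_derive_eq; apply.
rewrite mulmxDl.
have -> (X Y Z : 'M[R]_1) : (X + Y + Z) 0 0 = X 0 0 + Y 0 0 + Z 0 0 by rewrite !mxE.
by rewrite -/(quad _ _) (bilin_sym dw (w x) sQ); ring.
Qed.

Lemma differentiable_bigsum (W : normedModType R) (I : Type) (r : seq I)
    (f : I -> V -> W) x :
  (forall i, differentiable (f i) x) ->
  differentiable (fun y => \sum_(i <- r) f i y) x.
Proof.
move=> h; elim: r => [|i r IH].
  by under eq_fun do rewrite big_nil; exact: differentiable_cst.
under eq_fun do rewrite big_cons.
exact: differentiableD.
Qed.

Lemma differentiable_cV n (F : V -> 'cV[R]_n) x :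
  (forall i, differentiable (fun y => F y i 0) x) -> differentiable F x.
Proof.
move=> h.
rewrite (_ : F = fun y => \sum_i F y i 0 *: delta_mx i 0); last first.
  apply/funext => y; apply/colP => i; rewrite summxE (bigD1 i)//= big1 => [|j ji].
    by rewrite !mxE !eqxx mulr1 addr0.
  by rewrite !mxE eq_sym (negbTE ji) mulr0.
apply: differentiable_bigsum => i.
exact: differentiableZl.
Qed.

End space_calculus.

Section gaussian_space.
Context {R : realType} {n : nat}.

Lemma differentiable_affine k (M : 'M[R]_(k, n)) (c : 'cV[R]_k) i u :
  differentiable (fun y : 'cV[R]_n => (M *m y - c) i 0) u.
Proof.
under eq_fun do rewrite !mxE.
apply: differentiableB; last exact: differentiable_cst.
apply: differentiable_bigsum => j.
by apply: differentiableM; [exact: differentiable_cst|exact: differentiable_coord].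
Qed.

Lemma differentiable_quad k (P : 'M[R]_k) (M : 'M[R]_(k, n)) (c : 'cV[R]_k) u :
  differentiable (fun y : 'cV[R]_n => quad P (M *m y - c)) u.
Proof.
under eq_fun do rewrite quadE.
apply: differentiable_bigsum => i; apply: differentiable_bigsum => j.
apply: differentiableM; last exact: differentiable_affine.
by apply: differentiableM; [exact: differentiable_cst|exact: differentiable_affine].
Qed.

Lemma is_derive_affine k (M : 'M[R]_(k, n)) (c : 'cV[R]_k) (u v : 'cV[R]_n) :
  is_derive u v (fun y => M *m y - c) (M *m v).
Proof.
have h := is_derive_mulmx (is_derive_cst M u v) (is_derive_id u v).
have := @is_deriveB _ _ _ _ _ _ _ _ _ h (is_derive_cst c u v).
by move/is_derive_eq; apply; rewrite mul0mx add0r subr0.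
Qed.

Lemma is_derive_quad_affine k (P : 'M[R]_k) (M : 'M[R]_(k, n)) (c : 'cV[R]_k)
    (u v : 'cV[R]_n) : P^T = P ->
  is_derive u v (fun y => quad P (M *m y - c))
    (2 * (v^T *m (M^T *m P *m (M *m u - c))) 0 0).
Proof.
move=> sP.
have := is_derive_quad sP (is_derive_cst P u v) (is_derive_affine M c u v).
move/is_derive_eq; apply.
rewrite /quad mulmx0 mul0mx mxE add0r; congr (_ * _).
by rewrite (bilin_sym _ _ sP) trmx_mul !mulmxA.
Qed.

Variables (Q : 'M[R]_n) (m : 'cV[R]_n) (c : R).
Hypothesis sQ : Q^T = Q.
Let rho (u : 'cV[R]_n) := c * expR (- 2^-1 * quad Q (u - m)).

Let rho_diff u : differentiable rho u.
Proof.
apply: differentiableM; first exact: differentiable_cst.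
apply: (@differentiable_comp _ _ _ _ (fun y => - 2^-1 * quad Q (y - m)) expR).
  apply: differentiableM; first exact: differentiable_cst.
  by have := differentiable_quad Q 1%:M m u; under eq_fun do rewrite mul1mx.
by apply/derivable1_diffP; case: (is_derive_expR (- 2^-1 * quad Q (u - m))).
Qed.

Let rho_derive u v : is_derive u v rho (- rho u * (v^T *m (Q *m (u - m))) 0 0).
Proof.
have h : is_derive u v (fun y => - 2^-1 * quad Q (y - m))
    (- (v^T *m (Q *m (u - m))) 0 0).
  have := is_derive_quad_affine 1%:M m u v sQ.
  under eq_fun do rewrite mul1mx.
  rewrite trmx1 !mul1mx => hq.
  by apply: is_derive_eq (is_derive_mul (is_derive_const _ _ _) hq) _; field.
have d : differentiable (fun y => - 2^-1 * quad Q (y - m)) u.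
  apply: differentiableM; first exact: differentiable_cst.
  by have := differentiable_quad Q 1%:M m u; under eq_fun do rewrite mul1mx.
apply: is_derive_eq (is_derive_mul (is_derive_const c _ _)
  (is_derive_comp (is_derive_expR _) d h)) _.
by rewrite /rho; ring.
Qed.

Let Drho u i : 'D_(evec i) rho u = - rho u * (Q *m (u - m)) i 0.
Proof. by have [_ ->] := rho_derive u (evec i); rewrite evec_dot. Qed.

Lemma differentiable_gauss u : differentiable rho u.
Proof. exact: rho_diff. Qed.

Lemma grad_gauss u : grad rho u = - rho u *: (Q *m (u - m)).
Proof. by apply/colP => i; rewrite 2!mxE Drho. Qed.

Lemma differentiable_grad_gauss u : differentiable (grad rho) u.
Proof.
apply: differentiable_cV => i.
rewrite (_ : (fun y => _) = fun y => - rho y * (Q *m y - Q *m m) i 0); last first.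
  by apply/funext => y; rewrite grad_gauss mxE mulmxBr.
apply: differentiableM; last exact: differentiable_affine.
exact: differentiableN.
Qed.

Lemma hessian_gauss u : hessian rho u =
  rho u *: ((Q *m (u - m)) *m (Q *m (u - m))^T - Q).
Proof.
apply/matrixP => i j; rewrite mxE.
under eq_fun do rewrite Drho.
have h : is_derive u (evec i) (fun y => (Q *m (y - m)) j 0) (Q j i).
  have /is_derive_mx/(_ j 0) := is_derive_affine Q (Q *m m) u (evec i).
  under eq_fun do rewrite -mulmxBr.
  by move/is_derive_eq; apply; rewrite /evec -colE mxE.
have hN : is_derive u (evec i) (fun y => - rho y) (rho u * (Q *m (u - m)) i 0).
  apply: is_derive_eq (is_deriveN (rho_derive u (evec i))) _.
  by rewrite evec_dot mulNr opprK.
have [_ ->] := is_derive_mul hN h.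
rewrite [RHS]mxE [in RHS]mxE [X in _ * (_ + X)]mxE.
rewrite [X in _ * (X + _)]mxE big_ord1 [(_^T) _ _]mxE.
by rewrite -[in Q j i]sQ mxE; ring.
Qed.

Lemma frobenius_gauss (C : 'M[R]_n) u : Q *m C = 1%:M -> C^T = C ->
  frobenius C (hessian rho u) = rho u * (quad Q (u - m) - n%:R).
Proof.
move=> QC sC; rewrite hessian_gauss /frobenius.
set w := u - m.
have quadC : quad C (Q *m w) = quad Q w.
  by rewrite /quad trmx_mul sQ !mulmxA -[w^T *m Q *m C]mulmxA QC mulmx1.
have trC : \sum_i \sum_j C i j * Q i j = n%:R.
  transitivity (\tr (Q *m C)); last by rewrite QC mxtrace1.
  rewrite /mxtrace; apply: eq_bigr => i _; rewrite mxE; apply: eq_bigr => j _.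
  by rewrite mulrC -[in RHS]sC mxE.
rewrite -quadC quadE -trC -sumrB mulr_sumr; apply: eq_bigr => i _.
rewrite -sumrB mulr_sumr; apply: eq_bigr => j _.
rewrite mxE [X in _ * (_ * X)]mxE [X in _ * (_ * (_ + X))]mxE.
rewrite [X in _ * (_ * (X + _))]mxE big_ord1 [(_^T) _ _]mxE.
by ring.
Qed.

Lemma differentiable_flux_gauss (C Bi : 'M[R]_n) (r : 'cV[R]_n) u :
  differentiable (fun v => rho v *: (C *m (Bi *m v - r))) u.
Proof.
apply: differentiable_cV => i.
under eq_fun do rewrite mxE mulmxBr mulmxA.
by apply: differentiableM; [exact: rho_diff|exact: differentiable_affine].
Qed.

Lemma divergence_flux_gauss (C Bi : 'M[R]_n) (r : 'cV[R]_n) u : Q *m C = 1%:M ->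
  divergence (fun v => rho v *: (C *m (Bi *m v - r))) u =
  rho u * (\tr (C *m Bi) - ((u - m)^T *m (Bi *m u - r)) 0 0).
Proof.
move=> QC; rewrite /divergence.
pose x := Q *m (u - m); pose y := C *m (Bi *m u - r).
have xy : (x^T *m y) 0 0 = ((u - m)^T *m (Bi *m u - r)) 0 0.
  by rewrite /x /y trmx_mul sQ !mulmxA -[(u - m)^T *m Q *m C]mulmxA QC mulmx1.
rewrite -xy mxE /mxtrace -sumrB mulr_sumr; apply: eq_bigr => i _.
under eq_fun do rewrite mxE mulmxBr mulmxA.
have h : is_derive u (evec i) (fun v => (C *m Bi *m v - C *m r) i 0) ((C *m Bi) i i).
  have /is_derive_mx/(_ i 0) := is_derive_affine (C *m Bi) (C *m r) u (evec i).
  by move/is_derive_eq; apply; rewrite /evec -colE mxE.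
have [_ ->] := is_derive_mul (rho_derive u (evec i)) h.
rewrite evec_dot -/x -mulmxA -mulmxBr -/y [x^T 0 i]mxE.
by ring.
Qed.

End gaussian_space.

(** * Gaussian profiles parametrised by the precision *)

Section precision_form.
Context {R : realType} {n : nat}.

(** The Gaussian density with covariance [invmx Q].  Along the flow [Q] is
    an explicit combination of two fixed matrices, so that no inverse has to be
    differentiated. *)
Definition gaussP (m : 'cV[R]_n) (Q : 'M[R]_n) (u : 'cV[R]_n) : R :=
  ((2 * pi) `^ (n%:R / 2))^-1 * Num.sqrt (\det Q) * expR (- 2^-1 * quad Q (u - m)).

Lemma gaussian_invmx (m : 'cV[R]_n) (Q : 'M[R]_n) : spd Q ->
  gaussian m (invmx Q) = gaussP m Q.
Proof.
move=> spdQ; apply/funext => u; rewrite gaussianE; last exact: spd_inv.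
rewrite invmxK det_inv /gaussP; congr (_ * _ * _).
have d0 := spd_det_gt0 spdQ.
by rewrite powRN powR12_sqrt ?invr_ge0 ?ltW// sqrtrV ?ltW// invrK.
Qed.

Lemma mulmx1_invmx (Q C : 'M[R]_n) : Q *m C = 1%:M -> C = invmx Q.
Proof.
move=> QC; have [uQ _] := mulmx1_unit QC.
by rewrite -[C](mulKmx uQ) QC mulmx1.
Qed.

Lemma cvg_det (T : Type) (F : set_system T) (FF : Filter F)
    (Q : T -> 'M[R]_n) (QL : 'M[R]_n) :
  mxcvg F Q QL -> \det (Q x) @[x --> F] --> \det QL.
Proof.
move=> h; apply: cvg_bigsum => s; apply: cvgM; first exact: cvg_cst.
by apply: cvg_bigprod => i; exact: h.
Qed.

Lemma cvg_gaussP (T : Type) (F : set_system T) (FF : Filter F)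
    (m : T -> 'cV[R]_n) (mL : 'cV[R]_n) (Q : T -> 'M[R]_n) (QL : 'M[R]_n) u :
  mxcvg F m mL -> mxcvg F Q QL -> gaussP (m x) (Q x) u @[x --> F] --> gaussP mL QL u.
Proof.
move=> hm hQ; apply: cvgM.
  apply: cvgM; first exact: cvg_cst.
  by apply: continuous_cvg; [exact: sqrt_continuous|exact: cvg_det].
have hw : mxcvg F (fun x => u - m x) (u - mL).
  by apply: mxcvgB => //; exact: mxcvg_cst.
have hq : quad (Q x) (u - m x) @[x --> F] --> quad QL (u - mL).
  by apply: mxcvgM => //; apply: mxcvgM => //; exact: mxcvgT.
have he : - 2^-1 * quad (Q x) (u - m x) @[x --> F] --> - 2^-1 * quad QL (u - mL).
  by apply: cvgM => //; exact: cvg_cst.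
by apply: continuous_cvg => //; exact: continuous_expR.
Qed.

End precision_form.

Lemma quadZB {R : realType} n (a : R) (P Q : 'M[R]_n) (w : 'cV[R]_n) :
  quad (a *: (P - Q)) w = a * (quad P w - quad Q w).
Proof.
rewrite /quad -scalemxAr -scalemxAl mulmxBr mulmxBl.
by have -> (X Y : 'M[R]_1) : (a *: (X - Y)) 0 0 = a * (X 0 0 - Y 0 0) by rewrite !mxE.
Qed.

Section time_derivative.
Context {R : realType} {n : nat}.
Variables (Bi P0 : 'M[R]_n).
Hypotheses (spdBi : spd Bi) (spdP0 : spd P0).
Local Notation Q := (precision Bi P0).

(** In the coordinates of [simult_diag], det Q is a constant times the product
    of the d_i, so half its logarithmic derivative is the sum of
    (lam_i - d_i) / d_i, that is tr (C Bi) - n. *)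
Lemma is_derive_sqrt_det (C : 'M[R]_n) (t : R) : 0 <= t -> Q t *m C = 1%:M ->
  is_derive t (1 : R) (fun s => Num.sqrt (\det (Q s)))
    (Num.sqrt (\det (Q t)) * (\tr (C *m Bi) - n%:R)).
Proof.
move=> t0 QC; have [G [lam [uG P0E BiE]]] := simult_diag spdP0 (proj1 spdBi).
pose e i s : R := prec_diag lam s 0 i.
have e0 i : e i t != 0 by rewrite gt_eqF// (prec_diag_gt0 spdBi uG BiE).
have detE s : \det (Q s) = \det G ^+ 2 * \prod_i e i s.
  by rewrite (precision_diag P0E BiE) !det_mulmx det_tr det_diag expr2; ring.
have dd := is_derive_mul (is_derive_const (\det G ^+ 2) _ _)
   (is_derive_prod (index_enum _) e0 (fun i => is_derive_prec_diag lam t i)).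
have dQ : is_derive t (1 : R) (fun s => \det (Q s))
   (\det (Q t) * \sum_i 2 * (lam 0 i - e i t) / e i t).
  under eq_fun do rewrite detE.
  by apply: is_derive_eq dd _; rewrite detE; ring.
have Qt0 := spd_det_gt0 (spd_precision spdBi spdP0 t0).
apply: is_derive_eq (is_derive1_comp (is_derive1_sqrt Qt0) dQ) _.
have sq0 : Num.sqrt (\det (Q t)) != 0 by rewrite gt_eqF// sqrtr_gt0.
have -> : \tr (C *m Bi) = \sum_i lam 0 i / e i t.
  pose X := G *m C *m G^T.
  have DC : diag_mx (prec_diag lam t) *m X = 1%:M.
    rewrite /X !mulmxA; apply: mulmx1C.
    by rewrite !mulmxA -(precision_diag P0E BiE).
  have -> : \tr (C *m Bi) = \tr (X *m diag_mx lam).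
    by rewrite BiE !mulmxA mxtrace_mulC !mulmxA.
  rewrite /mxtrace; apply: eq_bigr => i _.
  move/matrixP/(_ i i): DC; rewrite mul_diag_mx mul_mx_diag mxE [(1%:M : 'M[R]_n) i i]mxE eqxx => h.
  rewrite mxE; apply: (mulfI (e0 i)); rewrite mulrA h mul1r.
  by field.
have -> : n%:R = \sum_(i < n) 1 :> R by rewrite sumr_const card_ord.
rewrite -sumrB -{2}(sqr_sqrtr (ltW Qt0)) !mulr_sumr; apply: eq_bigr => i _.
by field; rewrite sq0 e0.
Qed.

(** With w = u - m t, the derivative of <w, Q w> is
    2 <w, (Bi - Q) w> + 2 <w, Bi m - r>, because Q cancels the factor [C] of m';
    the terms recombine into <w, Bi u - r> as Bi w + Bi m = Bi u. *)
Lemma is_derive_gaussP (C : 'M[R]_n) (m : R -> 'cV[R]_n) (r u : 'cV[R]_n) (t : R) :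
  0 <= t -> Q t *m C = 1%:M ->
  is_derive t (1 : R) m (- (C *m (Bi *m m t - r))) ->
  is_derive t (1 : R) (fun s => gaussP (m s) (Q s) u)
    (gaussP (m t) (Q t) u *
     (\tr (C *m Bi) - n%:R - ((u - m t)^T *m (Bi *m u - r)) 0 0
      + quad (Q t) (u - m t))).
Proof.
move=> t0 QC dm; set w := u - m t; set Qt := Q t.
have sQ : Qt^T = Qt := proj1 (spd_precision spdBi spdP0 t0).
have dw : is_derive t (1 : R) (fun s => u - m s) (C *m (Bi *m m t - r)).
  have := is_deriveB (is_derive_cst u t (1 : R)) dm.
  by move/is_derive_eq; apply; rewrite sub0r opprK.
have dq := is_derive_quad sQ (is_derive_precision Bi P0 t) dw.
have dh := is_derive_mul (is_derive_const (- 2^-1) _ _) dq.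
have de := is_derive1_comp (is_derive_expR _) dh.
have ds := is_derive_mul (is_derive_const (((2 * pi) `^ (n%:R / 2))^-1) _ _)
  (is_derive_sqrt_det t0 QC).
apply: is_derive_eq (is_derive_mul ds de) _.
rewrite -/w -/Qt.
have -> : (w^T *m Qt *m (C *m (Bi *m m t - r))) 0 0 = (w^T *m (Bi *m m t - r)) 0 0.
  by rewrite !mulmxA -[w^T *m Qt *m C]mulmxA QC mulmx1.
rewrite quadZB.
have -> : (w^T *m (Bi *m u - r)) 0 0 = quad Bi w + (w^T *m (Bi *m m t - r)) 0 0.
  rewrite /quad -mulmxA.
  have <- (X Y : 'M[R]_1) : (X + Y) 0 0 = X 0 0 + Y 0 0 by rewrite mxE.
  by rewrite -mulmxDr addrA -mulmxDr /w subrK.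
rewrite /gaussP -/Qt -/w; move: (w^T *m _) => X.
rewrite -[(_ \o _) t]/(expR (- 2^-1 * quad Qt w)).
by field; rewrite gt_eqF// powR_gt0// mulr_gt0// pi_gt0.
Qed.

End time_derivative.

(** * Convergence of densities in L1 *)

Section scheffe.
Context {R : realType} d (T : measurableType d) (mu : {measure set T -> \bar R}).

(** |f_k - f| + f = f_k + 2 (f - f_k)^+ pointwise, and f_k and f have the same
    integral, so the L1 distance is twice the integral of (f - f_k)^+, which is
    dominated by [f]. *)
Lemma scheffe (f_ : nat -> T -> R) (f : T -> R) :
  (forall k, measurable_fun setT (f_ k)) -> measurable_fun setT f ->
  (forall k x, 0 <= f_ k x) -> (forall x, 0 <= f x) ->
  (forall k, \int[mu]_x (f_ k x)%:E = 1)%E -> (\int[mu]_x (f x)%:E = 1)%E ->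
  (forall x, f_ k x @[k --> \oo] --> f x) ->
  ((\int[mu]_x `|f_ k x - f x|%:E) @[k --> \oo] --> 0)%E.
Proof.
move=> mf_ mf f_0 f0 f_1 f1 f_f.
pose g k x := Num.max (f x - f_ k x) 0.
have mg k : measurable_fun setT (g k).
  by apply: measurable_maxr => //; exact: measurable_funB.
have g0 k x : 0 <= g k x by rewrite le_max lexx orbT.
have gf k x : g k x <= f x.
  by rewrite ge_max f0 andbT lerBlDr lerDl f_0.
have fi : mu.-integrable setT (EFin \o f).
  apply/integrableP; split; first exact/measurable_EFinP.
  under eq_integral do rewrite /= ger0_norm//.
  by rewrite f1 ltry.
have ig : (\int[mu]_x (g k x)%:E @[k --> \oo] --> 0)%E.
  have gE : {ae mu, forall x, setT x -> (g k x)%:E @[k --> \oo] --> cst 0%E x}.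
    apply: aeW => x _; apply: cvg_EFin; first exact: nearW.
    apply: (@squeeze_cvgr _ _ _ _ (cst 0) (fun k => `|f x - f_ k x|)).
    - by apply: nearW => k; rewrite g0 ge_max ler_norm normr_ge0.
    - exact: cvg_cst.
    - rewrite -(@normr0 _ R) -[X in `|X|](subrr (f x)).
      by apply: cvg_norm; apply: cvgB => //; exact: cvg_cst.
  have gle : {ae mu, forall x k, setT x -> (`|(g k x)%:E| <= (EFin \o f) x)%E}.
    by apply: aeW => x k _; rewrite /= lee_fin ger0_norm.
  have [_ _] := @dominated_convergence _ T R mu setT measurableT
    (fun k x => (g k x)%:E) (cst 0%E) (EFin \o f)
    (fun k => (measurable_EFinP _ _).2 (mg k)) (measurable_cst _) gE fi gle.
  by rewrite integral0.
have E k : (\int[mu]_x `|f_ k x - f x|%:E = 2%:E * \int[mu]_x (g k x)%:E)%E.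
  have md : measurable_fun setT (fun x => `|f_ k x - f x|).
    by apply: measurableT_comp => //; exact: measurable_funB.
  have e : (\int[mu]_x `|f_ k x - f x|%:E + 1 = 2%:E * \int[mu]_x (g k x)%:E + 1)%E.
    have -> : (2%:E * \int[mu]_x (g k x)%:E = \int[mu]_x (2 * g k x)%:E)%E.
      symmetry; under eq_integral do rewrite EFinM.
      apply: (ge0_integralZl mu measurableT) => //.
      - by apply/measurable_EFinP; exact: mg.
      - by move=> x _; rewrite lee_fin.
    rewrite -{1}f1 -(f_1 k) -!ge0_integralD//; last 7 first.
    - by move=> x _; rewrite lee_fin mulr_ge0.
    - by apply/measurable_EFinP; exact: measurable_funM.
    - by move=> x _; rewrite lee_fin.
    - exact/measurable_EFinP.
    - exact/measurable_EFinP.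
    - by move=> x _; rewrite lee_fin.
    - exact/measurable_EFinP.
    apply: eq_integral => x _; rewrite -!EFinD; congr EFin.
    rewrite /g; case: (leP (f x - f_ k x) 0) => h.
      by rewrite ger0_norm; lra.
    by rewrite ltr0_norm; lra.
  by rewrite -[LHS](@addeK _ 1%E _)// e addeK.
under eq_fun do rewrite E.
by rewrite -(mule0 2%:E); exact: cvgeZl.
Qed.
End scheffe.

(** [scheffe] is about sequences of densities, whereas f t is a density for
    t >= 0 only; replacing t by max (t, 0) does not change the limit. *)
Lemma cvg_L1_dist (R : realType) d (f : R -> 'cV[R]_d -> R) (g : 'cV[R]_d -> R) :
  (forall t, 0 <= t -> pdensity (f t)) -> pdensity g ->
  (forall u, f t u @[t --> +oo] --> g u) ->
  L1_dist (f t) g @[t --> +oo] --> 0%E.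
Proof.
move=> ft [g0 mg g1] fg.
pose F t := f (Num.max t 0).
have Fd t : pdensity (F t) by apply: ft; rewrite le_max lexx orbT.
have Fnear u : F t u @[t --> +oo] --> g u.
  apply: cvg_trans (fg u); apply: near_eq_cvg; near=> t.
  by rewrite /F max_l//; near: t; exact: nbhs_pinfty_ge.
have seqc (v : R^nat) : v k @[k --> \oo] --> +oo ->
    L1_dist (F (v k)) g @[k --> \oo] --> 0%E.
  move=> voo; apply: scheffe.
  - by move=> k; have [] := Fd (v k).
  - exact: mg.
  - by move=> k x; have [h _ _] := Fd (v k); exact: h.
  - by move=> x; exact: g0.
  - by move=> k; have [] := Fd (v k).
  - exact: g1.
  - by move=> x; have /cvg_pinftyP := Fnear (col_of_tuple x); exact.
have Ffin t : L1_dist (F t) g \is a fin_num.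
  have [F0 mF F1] := Fd t.
  rewrite ge0_fin_numE; last by apply: integral_ge0 => x _; rewrite lee_fin.
  apply: (@le_lt_trans _ _ (\int[lebesgue_Rd d]_x
     ((F t (col_of_tuple x))%:E + (g (col_of_tuple x))%:E))%E).
    apply: ge0_le_integral => //.
    - apply/measurable_EFinP; apply: measurableT_comp => //.
      exact: measurable_funB.
    - by apply: emeasurable_funD; exact/measurable_EFinP.
    - move=> x _; rewrite -EFinD lee_fin (le_trans (ler_normB _ _))//.
      by rewrite !ger0_norm.
  rewrite ge0_integralD//.
  - by rewrite F1 g1 ltry.
  - by move=> x _; rewrite lee_fin.
  - exact/measurable_EFinP.
  - by move=> x _; rewrite lee_fin.
  - exact/measurable_EFinP.
have Fc : L1_dist (F t) g @[t --> +oo] --> 0%E.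
  apply: cvg_EFin; first exact: nearW.
  apply/cvg_pinftyP => v /seqc /fine_cvgP[_].
  exact.
apply: cvg_trans Fc; apply: near_eq_cvg; near=> t.
by rewrite /F max_l//; near: t; exact: nbhs_pinfty_ge.
Unshelve. all: by end_near.
Qed.

(** The two sides are proportional, and the right-hand one has mass one. *)
Lemma normalized_gaussian (R : realType) d (B : 'M[R]_d) (u0 : 'cV[R]_d) : spd B ->
  normalized (fun u => expR (- 2^-1 * wnorm B (u - u0) ^+ 2)) = gaussian u0 B.
Proof.
move=> spdB; have [gd0 mgd gd1] := pdensity_gaussian u0 spdB.
pose k : R := ((2 * pi) `^ (d%:R / 2))^-1 * (\det B) `^ (- 2^-1).
have k0 : k != 0.
  rewrite mulf_neq0// ?invr_eq0 gt_eqF// powR_gt0 ?spd_det_gt0//.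
  by rewrite mulr_gt0// pi_gt0.
have gE u : expR (- 2^-1 * wnorm B (u - u0) ^+ 2) = k^-1 * gaussian u0 B u.
  by rewrite /gaussian -/k mulKf.
apply/funext => u; rewrite /normalized.
have -> : int_Rd (fun u => expR (- 2^-1 * wnorm B (u - u0) ^+ 2)) = k^-1.
  rewrite /int_Rd; under eq_Rintegral do rewrite gE.
  rewrite RintegralZl//; first by rewrite /Rintegral gd1 mulr1.
  apply/integrableP; split; first exact/measurable_EFinP.
  under eq_integral do rewrite /= ger0_norm//.
  by rewrite gd1 ltry.
by rewrite gE invrK mulrC mulKf ?invr_eq0// mulrA mulfV// mul1r.
Qed.

(** * The Fokker-Planck equation *)

Section solution.
Context {R : realType} {d : nat}.
Variables (Phi : 'cV[R]_d -> R) (B : 'M[R]_d) (r m0 : 'cV[R]_d) (C0 : 'M[R]_d).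
Variables (m : R -> 'cV[R]_d) (C : R -> 'M[R]_d).
Hypotheses (spdB : spd B) (spdC0 : spd C0).
Hypothesis gradPhi : forall u, grad Phi u = invmx B *m u - r.
Hypothesis ode : solves_moment_odes B r m0 C0 m C.

Let Bi := invmx B.
Let P0 := invmx C0.
Let spdBi : spd Bi := spd_inv spdB.
Let spdP0 : spd P0 := spd_inv spdC0.
Local Notation Q := (precision Bi P0).

Let QC t : 0 <= t -> Q t *m C t = 1%:M.
Proof.
have [_ [C00 Cc] _ dC] := ode; apply: precision_unique => //.
- by rewrite C00.
- by rewrite C00 mulVmx// spd_unit.
Qed.

Let CE t : 0 <= t -> C t = invmx (Q t).
Proof. by move=> t0; exact: mulmx1_invmx (QC t0). Qed.

Let spdQ t : 0 <= t -> spd (Q t).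
Proof. exact: spd_precision. Qed.

Lemma spd_covariance t : 0 <= t -> spd (C t).
Proof. by move=> t0; rewrite CE//; exact/spd_inv/spdQ. Qed.

Let rhoE t : 0 <= t -> gaussian (m t) (C t) = gaussP (m t) (Q t).
Proof. by move=> t0; rewrite CE// gaussian_invmx//; exact: spdQ. Qed.

Lemma gaussian_solves : solves_fokker_planck Phi (gaussian m0 C0)
  (fun t => gaussian (m t) (C t)).
Proof.
have [[m00 mc] [C00 Cc] dm dC] := ode.
have fluxE t : 0 <= t -> (fun v => gaussian (m t) (C t) v *:
     (covariance_mx (gaussian (m t) (C t)) *m grad Phi v)) =
   (fun v => gaussP (m t) (Q t) v *: (C t *m (Bi *m v - r))).
  move=> t0; apply/funext => v; rewrite covariance_gaussian ?gradPhi ?rhoE//.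
  exact: spd_covariance.
split.
- move=> t t0; have sC := spd_covariance t0.
  by split; [exact: pdensity_gaussian|exact: finite_second_moment_gaussian].
- move=> u; rewrite m00 C00; split=> //.
  have -> : gaussian m0 C0 u = gaussP m0 (Q 0) u.
    by rewrite -C00 -m00 rhoE.
  apply: cvg_trans (_ : gaussP (m t) (Q t) u @[t --> 0^'+] --> _).
    by apply: near_eq_cvg; near=> t; rewrite rhoE.
  apply: cvg_gaussP; first exact: cvg_mxcvg mc.
  apply: cvg_mxcvg; apply: cvg_at_right_filter.
  exact: is_derive_continuous (is_derive_precision Bi P0 0).
- move=> t u t0; have t0' := ltW t0; have sQ := proj1 (spdQ t0').
  rewrite fluxE// rhoE//; split.
  + exact: differentiable_gauss.
  + exact: differentiable_grad_gauss.
  + exact: differentiable_flux_gauss.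
- move=> t u t0; have t0' := ltW t0; have [sQ _] := spdQ t0'.
  have sC := spd_covariance t0'.
  rewrite fluxE// covariance_gaussian// rhoE//.
  rewrite divergence_flux_gauss// ?QC//.
  rewrite frobenius_gauss//; [|exact: QC|exact: (proj1 sC)].
  apply: (@near_eq_is_derive _ _ _ (fun s => gaussP (m s) (Q s) u)).
    by near=> s; rewrite rhoE//; apply: ltW; near: s; exact: lt_nbhsr.
  apply: is_derive_eq (is_derive_gaussP spdBi spdP0 u t0' (QC t0') (dm t t0)) _.
  by rewrite /gaussP; ring.
Unshelve. all: by end_near.
Qed.

Lemma cvg_mean_solution : mxcvg +oo m (B *m r).
Proof.
have [[m00 mc] _ dm _] := ode.
have [G [lam [uG P0E BiE]]] := simult_diag spdP0 (proj1 spdBi).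
have BiB : Bi *m (B *m r) = r by rewrite mulKmx// spd_unit.
have w0 : mxcvg +oo (fun t => m t - B *m r) 0.
  apply: (cvg_deviation0 spdBi uG P0E BiE QC).
    rewrite m00; apply: mxcvgB; last exact: mxcvg_cst.
    exact: cvg_mxcvg.
  move=> t t0.
  have := is_deriveB (dm t t0) (is_derive_cst (B *m r) t (1 : R)).
  by move/is_derive_eq; apply; rewrite subr0 [Bi *m (_ - _)]mulmxBr BiB.
have h : mxcvg +oo (fun _ : R => B *m r) (B *m r) by exact: mxcvg_cst.
rewrite -[X in mxcvg _ _ X]add0r.
rewrite (_ : m = fun t => m t - B *m r + B *m r); first exact: mxcvgD.
by apply/funext => t; rewrite subrK.
Qed.

Lemma cvg_gaussian_solution u :
  gaussian (m t) (C t) u @[t --> +oo] --> gaussian (B *m r) B u.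
Proof.
have -> : gaussian (B *m r) B u = gaussP (B *m r) Bi u.
  by rewrite -(gaussian_invmx _ spdBi) /Bi invmxK.
apply: cvg_trans (_ : gaussP (m t) (Q t) u @[t --> +oo] --> _).
  by apply: near_eq_cvg; near=> t; rewrite rhoE//; near: t; exact: nbhs_pinfty_ge.
by apply: cvg_gaussP; [exact: cvg_mean_solution|exact: cvg_precision].
Unshelve. all: by end_near.
Qed.

End solution.

(** [moment_odes_explicit] solves the equation of the deviation m - B r. *)
Lemma moment_odes_exist (R : realType) d (B : 'M[R]_d) (r m0 : 'cV[R]_d)
    (C0 : 'M[R]_d) : spd B -> spd C0 ->
  exists m : R -> 'cV[R]_d, exists C : R -> 'M[R]_d,
    solves_moment_odes B r m0 C0 m C.
Proof.
move=> spdB spdC0; have spdBi := spd_inv spdB; have spdP0 := spd_inv spdC0.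
have [G [lam [uG P0E BiE]]] := simult_diag spdP0 (proj1 spdBi).
have PC0 : invmx C0 *m C0 = 1%:M by rewrite mulVmx// spd_unit.
have BiB : invmx B *m (B *m r) = r by rewrite mulKmx// spd_unit.
have [C [w [hC [w00 wc] dC dw]]] :=
  moment_odes_explicit spdBi uG P0E BiE (m0 - B *m r) PC0.
exists (fun t => w t + B *m r), C; split=> //.
- rewrite w00 subrK; split=> //.
  rewrite -[X in _ --> X](subrK (B *m r)).
  by apply: cvgD => //; exact: cvg_cst.
- move=> t t0.
  have := is_deriveD (dw t t0) (is_derive_cst (B *m r) t (1 : R)).
  by move/is_derive_eq; apply; rewrite addr0 [invmx B *m (_ + _)]mulmxDr BiB addrK.
Qed.

Lemma grad_potential (R : realType) (K d : nat)
    (A : 'M[R]_(K, d)) (y : 'cV[R]_K) (Gamma : 'M[R]_K) (Gamma0 : 'M[R]_d) u :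
  spd Gamma -> spd Gamma0 ->
  grad (fun u : 'cV[R]_d =>
    2^-1 * wnorm Gamma (A *m u - y) ^+ 2 + 2^-1 * wnorm Gamma0 u ^+ 2) u =
  (A^T *m invmx Gamma *m A + invmx Gamma0) *m u - A^T *m invmx Gamma *m y.
Proof.
move=> sG sG0; apply/colP => i; rewrite mxE.
have -> : (fun u : 'cV[R]_d =>
    2^-1 * wnorm Gamma (A *m u - y) ^+ 2 + 2^-1 * wnorm Gamma0 u ^+ 2) =
  fun u => 2^-1 * quad (invmx Gamma) (A *m u - y) +
           2^-1 * quad (invmx Gamma0) (1%:M *m u - 0).
  by apply/funext => v; rewrite mul1mx subr0 !wnormE.
have h1 := is_derive_quad_affine A y u (evec i) (proj1 (spd_inv sG)).
have h2 := is_derive_quad_affine 1%:M 0 u (evec i) (proj1 (spd_inv sG0)).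
have [_ ->] := is_derive_add (is_derive_mul (is_derive_const 2^-1 _ _) h1)
  (is_derive_mul (is_derive_const 2^-1 _ _) h2).
rewrite trmx1 !mul1mx subr0 !evec_dot !mulr0 !addr0 !mulrA mulVf// !mul1r.
rewrite mulmxDl mulmxBr !mulmxA.
move: (_ *m A *m u) (_ *m y) (_ *m u) => X Y Z; rewrite !mxE; ring.
Qed.

Theorem proposition4 (R : realType) (K d : nat)
    (A : 'M[R]_(K, d)) (y : 'cV[R]_K) (Gamma : 'M[R]_K) (Gamma0 : 'M[R]_d)
    (spd_Gamma : spd Gamma) (spd_Gamma0 : spd Gamma0)
    (m0 : 'cV[R]_d) (C0 : 'M[R]_d) (spd_C0 : spd C0) :
  let Phi_R := fun u : 'cV[R]_d =>
    2^-1 * wnorm Gamma (A *m u - y) ^+ 2 + 2^-1 * wnorm Gamma0 u ^+ 2 in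
  let r := A^T *m invmx Gamma *m y in
  let B := invmx (A^T *m invmx Gamma *m A + invmx Gamma0) in
  let u0 := B *m r in
  let rho0 := gaussian m0 C0 in
  let rho_inf :=
    normalized (fun u => expR (- 2^-1 * wnorm B (u - u0) ^+ 2)) in
  [/\ [/\ pdensity rho0, mean rho0 = m0 & covariance_mx rho0 = C0],
      pdensity rho_inf,
      exists m : R -> 'cV[R]_d, exists C : R -> 'M[R]_d,
        solves_moment_odes B r m0 C0 m C &
      forall (m : R -> 'cV[R]_d) (C : R -> 'M[R]_d),
        solves_moment_odes B r m0 C0 m C ->
        let rho := fun t : R => gaussian (m t) (C t) in
        [/\ forall t : R, 0 <= t -> spd (C t),
            solves_fokker_planck Phi_R rho0 rho,
            forall u, rho t u @[t --> +oo] --> rho_inf u &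
            L1_dist (rho t) rho_inf @[t --> +oo] --> 0%E]].
Proof.
move=> Phi_R r B u0 rho0 rho_inf.
have spdB : spd B.
  apply: spd_inv; apply: psd_spd_add; last exact: spd_inv.
    by apply: trmx_congr; exact: (proj1 (spd_inv spd_Gamma)).
  move=> a; have := spd_psd (A *m a) (spd_inv spd_Gamma).
  by rewrite trmx_mul !mulmxA.
have rho_infE : rho_inf = gaussian u0 B by exact: normalized_gaussian.
have gradPhi u : grad Phi_R u = invmx B *m u - r.
  by rewrite /Phi_R grad_potential// /B invmxK.
split.
- split; [exact: pdensity_gaussian|exact: mean_gaussian|exact: covariance_gaussian].
- by rewrite rho_infE; exact: pdensity_gaussian.
- exact: moment_odes_exist.
- move=> m C ode rho; have spdC := spd_covariance spdB spd_C0 ode.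
  have pointwise u : rho t u @[t --> +oo] --> rho_inf u.
    by rewrite rho_infE; exact: cvg_gaussian_solution spdB spd_C0 ode u.
  split=> //; first exact: gaussian_solves spdB spd_C0 gradPhi ode.
  apply: cvg_L1_dist => // [t t0|].
    exact/pdensity_gaussian/spdC.
  by rewrite rho_infE; exact: pdensity_gaussian.
Qed.
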